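(* Let $\omega\subset\mathbb{R}^2$ be a bounded, convex, Lipschitz domain. Let $v\in\mathcal{V}_0$ and let $A\in C^\infty(\overline\omega;\mathbb{R}^{2\times2}_{\rm sym})$ be such that $A\equiv0$ in a neighbourhood of $\{\nabla^2v=0\}$. Then there exist maps $\alpha,g_1,g_2\in C^\infty(\overline\omega)$ such that $\alpha=g_1=g_2=0$ on $\{\nabla^2v=0\}$ and, with $g=(g_1,g_2)$, $$A=\nabla_sg+\alpha\nabla^2v.$$
   Context: $\mathbb{R}^{2\times2}_{\rm sym}$ denotes the symmetric $2\times2$ matrices and $\nabla_sg=\frac12(\nabla g+\nabla^\top g)$. An isometry (isometric immersion) is a map $y:\omega\to\mathbb{R}^3$ with $\nabla^\top y\,\nabla y=I_2$. For a $W^{2,2}$ isometric immersion $y$, its second fundamental form is $\mathrm{II}=\mathrm{II}_{(y)}$, $\mathrm{II}_{ij}=y_{,i}\cdot(y_{,1}\wedge y_{,2})_{,j}$; it is singular and there is $f_y\in W^{1,2}(\omega;\mathbb{R}^2)$ with $\nabla f_y=\mathrm{II}$. A curve $\gamma:[0,l]\to\omega$ parametrised by arclength is a leading curve if it is orthogonal to the inverse images of $f_y$ on regions where $f_y$ is not constant; its unit normal $\nu$ and curvature $\kappa$ satisfy $\gamma''=\kappa\nu$ (and $\kappa$ is bounded, $\gamma\in W^{2,\infty}$). A subdomain $\omega'\subset\omega$ is covered by $\gamma$ if $\omega'\subset\{\gamma(t)+s\nu(t):s\in\mathbb{R},\,t\in[0,l]\}$. A body is a connected maximal subdomain on which $y$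 is affine and whose boundary contains more than two segments inside $\omega$. An arm is a maximal subdomain $\omega(\gamma)$ covered by some leading curve $\gamma$. The isometry $y$ is said to finitely partition $\omega$ if $\omega$ is partitioned by $y$ into finitely many bodies and arms. Set $$\mathcal{A}_0=\{y\in C^\infty(\overline\omega;\mathbb{R}^3): y\text{ is an isometry finitely partitioning }\omega\},$$ $$\mathcal{V}_0=\{v\in C^\infty(\overline\omega):\exists\,\eta>0\text{ such that }\eta v=y_3\text{ for some }y\in\mathcal{A}_0\},$$ where $y_3$ is the third component of $y$. *)

(* Defs.v *)
From HB Require Import structures.
From mathcomp Require Export all_boot all_order all_algebra.
From mathcomp Require Export all_classical all_reals all_analysis.

Set Implicit Arguments.
Unset Strict Implicit.
Unset Printing Implicit Defensive.

Import Order.TTheory GRing.Theory Num.Theory.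
Import numFieldNormedType.Exports.

Local Open Scope classical_set_scope.
Local Open Scope ring_scope.

(* Vectors are rows.  The library norm on them is the sup norm: it is used for
   topology, boundedness and Lipschitz continuity only, and Euclidean lengths
   and angles are expressed through [dot]. *)

Definition dot (R : realType) n (u w : 'rV[R]_n) : R :=
  \sum_(k < n) u 0 k * w 0 k.

Definition rot90 (R : realType) (u : 'rV[R]_2) : 'rV[R]_2 :=
  \row_j (if j == 0 then - u 0 1 else u 0 0).

(* The indices are computed modulo 3. *)
Definition wedge (R : realType) (u w : 'rV[R]_3) : 'rV[R]_3 :=
  \row_k (u 0 (k + 1) * w 0 (k + 2%:R) - u 0 (k + 2%:R) * w 0 (k + 1)).

Definition row2 (R : realType) (a b : R) : 'rV[R]_2 :=
  \row_j (if j == 0 then a else b).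

(* The indices 0 and 1 of 'I_2 stand for the coordinates x_1 and x_2. *)
Definition partial (R : realType) (W : normedModType R) (i : 'I_2)
    (f : 'rV[R]_2 -> W) (x : 'rV[R]_2) : W :=
  'D_(delta_mx 0 i : 'rV[R]_2) f x.

(* (grad f)_{ij} = d_j f_i *)
Definition grad (R : realType) n (f : 'rV[R]_2 -> 'rV[R]_n) (x : 'rV[R]_2) :
    'M[R]_(n, 2) :=
  \matrix_(i, j) (partial j f x) 0 i.

Definition sym_grad (R : realType) (g : 'rV[R]_2 -> 'rV[R]_2) (x : 'rV[R]_2) :
    'M[R]_2 :=
  2^-1 *: (grad g x + (grad g x)^T).

Definition hessian (R : realType) (f : 'rV[R]_2 -> R^o) (x : 'rV[R]_2) :
    'M[R]_2 :=
  \matrix_(i, j) partial j (partial i f) x.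

Fixpoint of_class_C (R : realType) (W : normedModType R) (k : nat)
    (f : 'rV[R]_2 -> W) : Prop :=
  match k with
  | 0 => continuous f
  | k'.+1 => (forall x, differentiable f x) /\
             (forall i, of_class_C k' (partial i f))
  end.

(* An element of C^oo(closure omega) is the restriction to [closure omega] of a
   smooth map on the whole plane, and it is represented below by such a map.
   All conditions are imposed on [closure omega] or on [omega] only, so they do
   not depend on the representative: as [omega] is open, its values on [omega]
   determine all its derivatives on [closure omega]. *)
Definition smooth (R : realType) (W : normedModType R) (f : 'rV[R]_2 -> W) :
    Prop :=
  forall k, of_class_C k f.

Definition boundary (T : topologicalType) (D : set T) : set T :=
  closure D `\` interior D.

Definition domain (R : realType) (D : set 'rV[R]_2) : Prop :=
  [/\ open D, connected D & D !=set0].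

(* Near each boundary point, in suitable orthonormal coordinates, the domain is
   the region strictly above the graph of a Lipschitz function. *)
Definition Lipschitz_domain (R : realType) (D : set 'rV[R]_2) : Prop :=
  domain D /\
  forall p, boundary D p ->
    exists (U : set 'rV[R]_2) (e : 'rV[R]_2) (h : R^o -> R^o),
      [/\ open_nbhs p U, dot e e = 1, lipschitz h &
          forall x, U x -> (D x <-> h (dot x e) < dot x (rot90 e))].

Definition isometry_on (R : realType) (omega : set 'rV[R]_2)
    (y : 'rV[R]_2 -> 'rV[R]_3) : Prop :=
  forall x, omega x -> (grad y x)^T *m grad y x = 1%:M.

Definition second_form (R : realType) (y : 'rV[R]_2 -> 'rV[R]_3)
    (x : 'rV[R]_2) : 'M[R]_2 :=
  \matrix_(i, j)
    dot (partial i y x)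
        (partial j (fun z => wedge (partial 0 y z) (partial 1 y z)) x).

(* [f] is a potential f_y of the second fundamental form.  For smooth [y] every
   Sobolev potential is a classical one, and it is unique up to an additive
   constant. *)
Definition II_potential (R : realType) (omega : set 'rV[R]_2)
    (y : 'rV[R]_2 -> 'rV[R]_3) (f : 'rV[R]_2 -> 'rV[R]_2) : Prop :=
  forall x, omega x -> differentiable f x /\ grad f x = second_form y x.

Definition constant_on (R : realType) (f : 'rV[R]_2 -> 'rV[R]_2)
    (V : set 'rV[R]_2) : Prop :=
  exists c, forall x, V x -> f x = c.

(* An open region in which [f] is constant on no nonempty open subset. *)
Definition nonconstancy_region (R : realType) (omega : set 'rV[R]_2)
    (f : 'rV[R]_2 -> 'rV[R]_2) (U : set 'rV[R]_2) : Prop :=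
  [/\ open U, U `<=` omega &
      forall V, open V -> V !=set0 -> V `<=` U -> ~ constant_on f V].

(* [d] is orthogonal at [p] to the inverse image f^-1(f p): every continuous
   curve that runs in this inverse image and is differentiable when it passes
   through [p] has there a velocity orthogonal to [d]. *)
Definition orthogonal_to_fiber (R : realType) (f : 'rV[R]_2 -> 'rV[R]_2)
    (p d : 'rV[R]_2) : Prop :=
  forall (c : R^o -> 'rV[R]_2) (w : 'rV[R]_2),
    continuous c -> c 0 = p -> is_derive (0 : R^o) (1 : R^o) c w ->
    (\forall s \near (0 : R^o), f (c s) = f p) ->
    dot w d = 0.

Definition unit_normal (R : realType) (gamma : R^o -> 'rV[R]_2) (t : R) :
    'rV[R]_2 :=
  rot90 (derive1 gamma t).

(* A curve on [0, l] of class W^{2,oo} is one whose derivative is Lipschitz; it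
   is represented by an extension to the real line which is also differentiable
   at the end points.  [kappa] is its curvature with respect to
   [unit_normal gamma]. *)
Definition leading_curve (R : realType) (omega : set 'rV[R]_2)
    (f : 'rV[R]_2 -> 'rV[R]_2) (l : R) (gamma : R^o -> 'rV[R]_2) : Prop :=
  [/\ 0 < l,
      forall t, 0 <= t <= l -> omega (gamma t),
      forall t, 0 <= t <= l ->
        derivable gamma t 1 /\ dot (derive1 gamma t) (derive1 gamma t) = 1,
      [lipschitz (derive1 gamma t) | t in [set t : R^o | 0 <= t <= l]] /\
      (exists kappa : R -> R,
        (exists K, forall t, 0 <= t <= l -> `|kappa t| <= K) /\
        {ae @lebesgue_measure R, forall t, 0 < t < l ->
           is_derive (t : R^o) (1 : R^o) (derive1 gamma)
             (kappa t *: unit_normal gamma t)}) &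
      forall U, nonconstancy_region omega f U ->
        forall t, 0 <= t <= l -> U (gamma t) ->
          orthogonal_to_fiber f (gamma t) (derive1 gamma t)].

Definition covered_by (R : realType) (l : R) (gamma : R^o -> 'rV[R]_2)
    (D : set 'rV[R]_2) : Prop :=
  forall x, D x -> exists t s, 0 <= t <= l /\ x = gamma t + s *: unit_normal gamma t.

Definition maximal_subdomain (R : realType) (omega : set 'rV[R]_2)
    (P : set 'rV[R]_2 -> Prop) (D : set 'rV[R]_2) : Prop :=
  [/\ domain D, D `<=` omega, P D &
      forall D', domain D' -> D' `<=` omega -> P D' -> D `<=` D' -> D' = D].

Definition affine_on (R : realType) (y : 'rV[R]_2 -> 'rV[R]_3)
    (D : set 'rV[R]_2) : Prop :=
  exists (M : 'M[R]_(2, 3)) (b : 'rV[R]_3), forall x, D x -> y x = x *m M + b.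

Definition open_segment (R : realType) (S : set 'rV[R]_2) : Prop :=
  exists a b : 'rV[R]_2,
    a != b /\ S = [set a + t *: (b - a) | t in [set t : R | 0 < t < 1]].

(* The segments of which the part of the boundary of [D] inside [omega]
   consists: maximality excludes their proper pieces. *)
Definition inner_boundary_segment (R : realType) (omega D S : set 'rV[R]_2) :
    Prop :=
  [/\ open_segment S, S `<=` omega `&` boundary D &
      forall S', open_segment S' -> S' `<=` omega `&` boundary D ->
        S `<=` S' -> S' = S].

Definition is_body (R : realType) (omega : set 'rV[R]_2)
    (y : 'rV[R]_2 -> 'rV[R]_3) (D : set 'rV[R]_2) : Prop :=
  maximal_subdomain omega (affine_on y) D /\
  exists S : 'I_3 -> set 'rV[R]_2,
    injective S /\ forall i, inner_boundary_segment omega D (S i).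

Definition is_arm (R : realType) (omega : set 'rV[R]_2)
    (y : 'rV[R]_2 -> 'rV[R]_3) (D : set 'rV[R]_2) : Prop :=
  exists f l gamma,
    [/\ II_potential omega y f, leading_curve omega f l gamma &
        maximal_subdomain omega (covered_by l gamma) D].

(* Bodies and arms are open, so they partition [omega] up to their
   boundaries. *)
Definition finitely_partitions (R : realType) (omega : set 'rV[R]_2)
    (y : 'rV[R]_2 -> 'rV[R]_3) : Prop :=
  exists (n : nat) (D : 'I_n -> set 'rV[R]_2),
    [/\ forall i, is_body omega y (D i) \/ is_arm omega y (D i),
        trivIset setT D &
        omega `<=` \bigcup_i closure (D i)].

Definition A0 (R : realType) (omega : set 'rV[R]_2)
    (y : 'rV[R]_2 -> 'rV[R]_3) : Prop :=
  [/\ smooth y, isometry_on omega y & finitely_partitions omega y].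

Definition V0 (R : realType) (omega : set 'rV[R]_2) (v : 'rV[R]_2 -> R^o) :
    Prop :=
  smooth v /\
  exists eta : R, 0 < eta /\
    exists y, A0 omega y /\
      forall x, closure omega x -> eta * v x = y x 0 ord_max.

Definition hessian_zeros (R : realType) (omega : set 'rV[R]_2)
    (v : 'rV[R]_2 -> R^o) : set 'rV[R]_2 :=
  [set x | closure omega x /\ hessian v x = 0].

(* Main.v *)
From HB Require Import structures.
Require Import Defs.
From mathcomp Require Import ring lra.
Import Order.TTheory GRing.Theory Num.Theory.
Import numFieldNormedType.Exports.
Local Open Scope classical_set_scope.
Local Open Scope ring_scope.

Set Implicit Arguments.
Unset Strict Implicit.
Unset Printing Implicit Defensive.

(** Why the theorem holds.

Only the degeneracy of the Hessian of [v] matters. For an isometry [y] of the flat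
metric the second derivatives of [y] are multiples of the unit normal and, by
Gauss's equation, their coefficients form a singular matrix; the Hessian of the
third component of [y], hence that of [v], is therefore singular on [omega], and by
continuity on its closure ([V0_developable], [developable_closure]).

Let x0 be a point of the closure where the Hessian does not vanish. One of its
diagonal entries, say the entry (j, j), is not zero there, and the kernel is spanned
by [(1, m)] in the coordinates (i, j), where [m] is the [slope]. Differentiating the
equation [det = 0] gives Burgers' equation [m_i + m m_j = 0] ([slope_burgers]) and
linear transport equations for the entry (j, j) and for [m_j] ([vjj_transport],
[slope_rate]). They hold up to the boundary, and integrating them along a line
shows that the slope is constant and the entry (j, j) does not vanish on the whole
part of the line that lies in the closure of the convex set [omega]: this is
[ruling_line], which covers lines contained in the boundary as well.

If [A] vanishes off a small neighbourhood of x0, the equation is solved by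
integrating along these lines. Eliminating the bending coefficient [alpha] from
the three scalar equations leaves one ordinary differential equation along the
ruling for the component [u] of [g] in the direction [(1, m)], and another one for
[g_j]. Their solutions are explicit: [u] is the integral of the strain along the
line of slope [m] through the given point, seen as a function of the point and of
the slope, and [g_j] is the derivative of [u] with respect to the slope
([displacement_j], [displacement_equations]). The coefficient [alpha] is then given
by the equation (j, j), in which one divides by the nonzero entry of the Hessian.
The integrals are taken along full straight lines of the plane, for a slope that is
smooth on the whole plane, so that smoothness reduces to differentiation under the
integral sign ([is_derive_int01]), and no flow has to be constructed.

The displacement so obtained is zero on the lines that do not meet the support of
[A]. By [ruling_line] and compactness, the lines starting in the domain near the
ruling of x0, but not very near, do not meet it, if it is small enough
([adapted_cutoffs]): multiplying by a cutoff localised around that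
ruling changes nothing near the ruling and makes everything vanish elsewhere, in
particular at the zeros of the Hessian ([local_equations]). As the problem is
linear and [A] vanishes near these zeros, finitely many local solutions add up to a
solution ([compact_solvable_near]). *)

(** * Partial derivatives and classes of differentiability *)

Section PartialDerivatives.
Context {R : realType}.
Implicit Types (f g : 'rV[R]_2 -> R^o) (x v : 'rV[R]_2) (i j : 'I_2) (k : nat).

Lemma derive_partials f x v : differentiable f x ->
  'D_v f x = \sum_k v 0 k * partial k f x.
Proof.
move=> df; rewrite deriveE// {1}(row_sum_delta v) linear_sum.
by apply: eq_bigr => k _; rewrite linearZ /partial deriveE.
Qed.

Lemma partial_cst i (c : R^o) : partial i (fun=> c) = fun=> (0 : R^o).
Proof. by apply/funext => x; rewrite /partial derive_cst. Qed.

Lemma partial_coord i j x : partial i (fun z => z 0 j : R^o) x = (i == j)%:R.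
Proof.
rewrite /partial deriveE; last exact: differentiable_coord.
have @L : {linear 'rV[R]_2 -> R^o}.
  by exists (fun N : 'rV[R]_2 => N 0 j); do 2![eexists]; do ?[constructor];
     rewrite ?mxE// => ? *; rewrite ?mxE//; move=> ?; rewrite !mxE.
rewrite (_ : (fun _ => _) = L)// diff_lin; last exact: coord_continuous.
by rewrite /= mxE eqxx/= eq_sym.
Qed.

Lemma partialD i f g x : differentiable f x -> differentiable g x ->
  partial i (fun z => f z + g z : R^o) x = partial i f x + partial i g x.
Proof. by move=> df dg; rewrite /partial deriveD//; exact: diff_derivable. Qed.

Lemma partialN i f x : differentiable f x ->
  partial i (fun z => - f z : R^o) x = - partial i f x.
Proof. by move=> df; rewrite /partial deriveN//; exact: diff_derivable. Qed.

Lemma partialB i f g x : differentiable f x -> differentiable g x ->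
  partial i (fun z => f z - g z : R^o) x = partial i f x - partial i g x.
Proof. by move=> df dg; rewrite /partial deriveB//; exact: diff_derivable. Qed.

Lemma partialM i f g x : differentiable f x -> differentiable g x ->
  partial i (fun z => f z * g z : R^o) x =
  f x * partial i g x + g x * partial i f x.
Proof. by move=> df dg; rewrite /partial deriveM//; exact: diff_derivable. Qed.

Lemma partialZ i (c : R) f x : differentiable f x ->
  partial i (fun z => c * f z : R^o) x = c * partial i f x.
Proof.
move=> df; rewrite partialM//.
by rewrite partial_cst mulr0 addr0.
Qed.

Lemma partialV i f x : differentiable f x -> f x != 0 ->
  partial i (fun z => (f z)^-1 : R^o) x = - ((f x)^-1 ^+ 2 * partial i f x).
Proof.
move=> df f0; rewrite /partial deriveV//; last exact: diff_derivable.
by rewrite exprVn scaleNr.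
Qed.

Lemma near_eq_partial i f g x : {near x, f =1 g} ->
  partial i f x = partial i g x.
Proof. exact: near_eq_derive. Qed.

Lemma of_class_CSP k f : of_class_C k.+1 f <->
  (forall x, differentiable f x) /\ (forall i, of_class_C k (partial i f)).
Proof. by []. Qed.

Lemma of_class_CS k f : of_class_C k.+1 f -> of_class_C k f.
Proof.
elim: k f => [|k IH] f [df cf]; last by split=> // i; exact/IH/cf.
by move=> x; exact: differentiable_continuous.
Qed.

Lemma of_class_C_continuous k f : of_class_C k f -> continuous f.
Proof. by elim: k => // k IH /of_class_CS. Qed.

Lemma of_class_C_cst k (c : R^o) :
  of_class_C k ((fun=> c) : 'rV[R]_2 -> R^o).
Proof.
elim: k c => [|k IH] c /=; first exact: cst_continuous.
split=> [x|i]; first exact: (@differentiable_cst _ _ R^o c).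
by rewrite partial_cst; exact: IH.
Qed.

Lemma of_class_C_coord k j :
  of_class_C k ((fun z => z 0 j) : 'rV[R]_2 -> R^o).
Proof.
case: k => [x|k]; first exact: coord_continuous.
split=> [x|i]; first exact: differentiable_coord.
rewrite (_ : partial _ _ = fun=> (i == j)%:R : R^o); first exact: of_class_C_cst.
by apply/funext => x; rewrite partial_coord.
Qed.

Lemma of_class_CD k f g : of_class_C k f -> of_class_C k g ->
  of_class_C k (fun z => f z + g z : R^o).
Proof.
elim: k f g => [|k IH] f g /= => [cf cg x|[df cf] [dg cg]].
  by apply: continuousD; [exact: cf|exact: cg].
split=> [x|i]; first by apply: (@differentiableD _ _ _ f g).
rewrite (_ : partial _ _ = fun z => partial i f z + partial i g z : R^o).
  exact: IH.
by apply/funext => x; rewrite partialD.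
Qed.

Lemma of_class_CM k f g : of_class_C k f -> of_class_C k g ->
  of_class_C k (fun z => f z * g z : R^o).
Proof.
elim: k f g => [|k IH] f g.
  by move=> cf cg x; apply: continuousM; [exact: cf|exact: cg].
move=> Cf Cg; have [/of_class_CSP[df cf] /of_class_CSP[dg cg]] := (Cf, Cg).
split=> [x|i]; first by apply: (@differentiableM _ _ f g).
rewrite (_ : partial _ _ =
    fun z => f z * partial i g z + g z * partial i f z : R^o).
  have [Cf0 Cg0] := (of_class_CS Cf, of_class_CS Cg).
  by apply: of_class_CD; apply: IH.
by apply/funext => x; rewrite partialM.
Qed.

Lemma of_class_CN k f : of_class_C k f -> of_class_C k (fun z => - f z : R^o).
Proof.
move=> Cf; rewrite (_ : (fun _ => _) = fun z => -1 * f z : R^o).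
  by apply: of_class_CM => //; exact: of_class_C_cst.
by apply/funext => z; rewrite mulN1r.
Qed.

Lemma of_class_CB k f g : of_class_C k f -> of_class_C k g ->
  of_class_C k (fun z => f z - g z : R^o).
Proof. by move=> Cf Cg; apply: of_class_CD => //; exact: of_class_CN. Qed.

Lemma of_class_CV k f : (forall z, f z != 0) -> of_class_C k f ->
  of_class_C k (fun z => (f z)^-1 : R^o).
Proof.
move=> f0; elim: k => [Cf x|k IH Cf].
  by apply: continuousV => //; exact: Cf.
have /of_class_CSP[df cf] := Cf; split=> [x|i].
  by apply: differentiableV.
rewrite (_ : partial _ _ =
    fun z => - ((f z)^-1 * (f z)^-1 * partial i f z) : R^o).
  have CV := IH (of_class_CS Cf).
  by apply/of_class_CN/of_class_CM => //; exact: of_class_CM.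
by apply/funext => x; rewrite partialV.
Qed.

Lemma smooth_partial i f : smooth f -> smooth (partial i f).
Proof. by move=> sf k; have [_] := sf k.+1; exact. Qed.

Lemma smooth_differentiable f x : smooth f -> differentiable f x.
Proof. by move=> /(_ 1) []. Qed.

Lemma smooth_continuous f : smooth f -> continuous f.
Proof. exact: (fun h => h 0). Qed.

Lemma smooth_cst (c : R^o) : smooth ((fun=> c) : 'rV[R]_2 -> R^o).
Proof. by move=> k; exact: of_class_C_cst. Qed.

Lemma smooth_coord j : smooth ((fun z => z 0 j) : 'rV[R]_2 -> R^o).
Proof. by move=> k; exact: of_class_C_coord. Qed.

Lemma smoothD f g : smooth f -> smooth g -> smooth (fun z => f z + g z : R^o).
Proof. by move=> sf sg k; exact: of_class_CD. Qed.

Lemma smoothM f g : smooth f -> smooth g -> smooth (fun z => f z * g z : R^o).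
Proof. by move=> sf sg k; exact: of_class_CM. Qed.

Lemma smoothN f : smooth f -> smooth (fun z => - f z : R^o).
Proof. by move=> sf k; exact: of_class_CN. Qed.

Lemma smoothB f g : smooth f -> smooth g -> smooth (fun z => f z - g z : R^o).
Proof. by move=> sf sg k; exact: of_class_CB. Qed.

Lemma smoothV f : (forall z, f z != 0) -> smooth f ->
  smooth (fun z => (f z)^-1 : R^o).
Proof. by move=> f0 sf k; exact: of_class_CV. Qed.

Lemma smooth_sum (I : Type) (r : seq I) (F : I -> 'rV[R]_2 -> R^o) :
  (forall a, smooth (F a)) -> smooth (fun z => \sum_(a <- r) F a z : R^o).
Proof.
move=> sF; elim: r => [|a r IH].
  by under eq_fun do rewrite big_nil; exact: smooth_cst.
by under eq_fun do rewrite big_cons; exact: smoothD.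
Qed.

Lemma partial_sum i (I : Type) (r : seq I) (F : I -> 'rV[R]_2 -> R^o) x :
  (forall a, smooth (F a)) ->
  partial i (fun z => \sum_(a <- r) F a z : R^o) x =
  \sum_(a <- r) partial i (F a) x.
Proof.
move=> sF; elim: r => [|a r IH].
  by under eq_fun do rewrite big_nil; rewrite partial_cst big_nil.
under eq_fun do rewrite big_cons.
rewrite partialD ?big_cons ?IH//; first exact: smooth_differentiable.
exact/smooth_differentiable/smooth_sum.
Qed.

Lemma partial_entry m n (M : 'rV[R]_2 -> 'M[R]_(m, n)) i a b x :
  differentiable M x ->
  partial i (fun z => M z a b : R^o) x = partial i M x a b.
Proof.
move=> dM; rewrite {2}/partial derive_mx ?mxE//.
exact: diff_derivable.
Qed.

Lemma of_class_C_entry k m n (M : 'rV[R]_2 -> 'M[R]_(m, n)) a b :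
  of_class_C k M -> of_class_C k (fun z => M z a b : R^o).
Proof.
elim: k M => [|k IH] M.
  move=> cM x; apply: (@continuous_comp _ _ _ M (fun A : 'M[R]_(m, n) => A a b : R^o)).
    exact: cM.
  exact: coord_continuous.
move=> [dM cM]; split=> [x|i].
  apply: (@differentiable_comp _ _ _ _ M (fun A : 'M[R]_(m, n) => A a b : R^o)) => //.
  exact: differentiable_coord.
rewrite (_ : partial _ _ = fun z => partial i M z a b : R^o).
  exact/IH/cM.
by apply/funext => x; rewrite partial_entry.
Qed.

Lemma smooth_entry m n (M : 'rV[R]_2 -> 'M[R]_(m, n)) a b :
  smooth M -> smooth (fun z => M z a b : R^o).
Proof. by move=> sM k; exact: of_class_C_entry. Qed.

End PartialDerivatives.

(** * The mean value theorem and continuously differentiable functions *)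

Section MeanValue.
Context {R : realType}.
Implicit Types (f g : 'rV[R]_2 -> R^o) (x v : 'rV[R]_2) (i j : 'I_2).

Lemma is_derive_line f x v (t : R) : derivable f (x + t *: v) v ->
  is_derive (t : R^o) (1 : R^o) (fun s : R^o => f (x + s *: v))
    ('D_v f (x + t *: v)).
Proof.
have E : (fun h : R => h^-1 *: (f (x + (h *: (1 : R^o) + t) *: v) -
      f (x + t *: v))) =
    (fun h : R => h^-1 *: (f (h *: v + (x + t *: v)) - f (x + t *: v))).
  by apply/funext => h; rewrite scalerDl [h *: (1 : R^o)]mulr1 addrCA.
by move=> df; apply: DeriveDef; rewrite /derivable /derive /= E.
Qed.

Lemma mean_value f x v (h : R) : (forall z, derivable f z v) ->
  exists2 t : R, `|t| <= `|h| & f (x + h *: v) - f x = h * 'D_v f (x + t *: v).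
Proof.
move=> df.
pose g (s : R) : R := f (x + s *: v).
have dg (t : R) : is_derive t 1 g ('D_v f (x + t *: v)) by exact: is_derive_line.
have cg (a b : R) : {within `[a, b], continuous g}.
  apply: continuous_subspaceT => t.
  by apply: differentiable_continuous; apply/derivable1_diffP.
have g0 : g 0 = f x by rewrite /g scale0r addr0.
have [h0|h0] := leP 0 h.
  have [t + E] := MVT_segment h0 (fun t _ => dg t) (cg 0 h).
  rewrite in_itv/= => /andP[t0 th]; exists t; first by rewrite !ger0_norm.
  by move: E; rewrite g0 subr0 mulrC.
have [t + E] := MVT_segment (ltW h0) (fun t _ => dg t) (cg h 0).
rewrite in_itv/= => /andP[t0 th]; exists t.
  by rewrite ler0_norm// ltr0_norm// lerN2.
by move: E; rewrite g0 sub0r mulrN => /eqP; rewrite -eqr_oppLR opprB mulrC => /eqP.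
Qed.

Lemma norm_coord_le n (h : 'rV[R]_n) (k : 'I_n) : `|h 0 k| <= `|h|.
Proof. by rewrite [leRHS]/Num.Def.normr/= mx_normrE (le_bigmax _ _ (0, k)). Qed.

Lemma norm_delta_mx n (k : 'I_n) : `|delta_mx 0 k : 'rV[R]_n| <= 1.
Proof.
rewrite [leLHS]/Num.Def.normr/= mx_normrE bigmax_le//= => -[a b] _ /=.
by rewrite mxE; case: (_ && _); rewrite ?normr1// normr0.
Qed.

Lemma ord2_case (i j k : 'I_2) : i != j -> k = i \/ k = j.
Proof.
move=> ij; case: (eqVneq k i) => [->|ki]; [by left|right; apply/val_inj => /=].
move: i j k ij ki => [[|[|//]] ?] [[|[|//]] ?] [[|[|//]] ?]//=.
Qed.

Lemma big_ord2 (F : 'I_2 -> R) i j : i != j -> \sum_k F k = F i + F j.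
Proof.
move=> ij; rewrite (bigD1 i)//=; congr (_ + _); rewrite (big_pred1 j)// => k.
by apply/idP/eqP => [ki|->]; [case: (ord2_case k ij) ki => ->; rewrite ?eqxx|rewrite eq_sym].
Qed.

(** The first-order expansion, with any coefficients, is all that Frechet
differentiability asks for. *)
Lemma differentiable_remainder f x (a : 'I_2 -> R) :
  (forall e : R, 0 < e -> \forall h \near (0 : 'rV[R]_2),
     `|f (h + x) - f x - \sum_k h 0 k * a k| <= e * `|h|) ->
  differentiable f x.
Proof.
move=> rem.
pose l (h : 'rV[R]_2) : R^o := \sum_k h 0 k * a k.
have l_lin : linear l.
  move=> r u w; rewrite /l scaler_sumr -big_split; apply: eq_bigr => k _.
  by rewrite !mxE mulrDl -mulrA.
pose lM := GRing.isLinear.Build _ _ _ _ _ l_lin.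
pose L : {linear 'rV[R]_2 -> R^o} := HB.pack l lM.
have cL : continuous L.
  rewrite (_ : (L : _ -> _) = fun h => h 0 0 * a 0 + h 0 1 * a 1 : R^o).
    apply: smooth_continuous.
    by apply: smoothD; (apply: smoothM; [exact: smooth_coord|exact: smooth_cst]).
  by apply/funext => h; rewrite /= /l (@big_ord2 _ 0 1).
have small e : 0 < e -> \forall h \near (0 : 'rV[R]_2),
    `|(f \o shift x - (cst (f x) + L)) h| <= e * `|h|.
  move=> e0; apply: filterS (rem e e0) => h.
  by rewrite !fctE/= /l opprD addrA.
have dE : 'd f x = L :> ('rV[R]_2 -> R^o).
  by apply: diff_unique => //; apply/eqaddoP => e; exact: small.
by apply/diff_locallyP; rewrite dE; split => //; apply/eqaddoP => e; exact: small.
Qed.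

(** The increment of [f] is split into one step along each axis; the mean value
theorem on each step compares it with the partial derivatives at [x]. *)
Lemma differentiable_C1 f : (forall z i, derivable f z (delta_mx 0 i)) ->
  (forall i, continuous (partial i f)) -> forall x, differentiable f x.
Proof.
move=> df cf x; apply: (@differentiable_remainder f x (fun k : 'I_2 => partial k f x)).
move=> e e0; have e20 : 0 < e / 2 by rewrite divr_gt0.
have near_partial i : exists2 d : R, 0 < d &
    forall z, `|z| < d -> `|partial i f (z + x) - partial i f x| <= e / 2.
  have /cvgrPdist_le/(_ _ e20)/nbhs_ballP[d d0 Hd] := cf i x.
  exists d => // z zd; rewrite distrC; apply: Hd.
  by rewrite -ball_normE/= opprD addrCA subrr addr0 normrN.
have [d d0 Hd] := near_partial 0; have [d' d'0 Hd'] := near_partial 1.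
have m0 : 0 < Num.min d d' by rewrite lt_min d0 d'0.
apply: filterS (nbhs0_lt (V := 'rV[R]_2) m0) => h.
rewrite lt_min => /andP[hd hd'].
rewrite (@big_ord2 _ 0 1)//.
have [s sh Es] := mean_value (x + h 0 1 *: delta_mx 0 1) (h 0 0) (df^~ 0).
have [t th Et] := mean_value x (h 0 1) (df^~ 1).
have hE : h + x = x + h 0 1 *: delta_mx 0 1 + h 0 0 *: delta_mx 0 0.
  rewrite addrC -addrA; congr (_ + _).
  apply/rowP => k; rewrite !mxE eqxx/=.
  by case: (@ord2_case 0 1 k) => // ->; rewrite !eqxx/= mulr0 mulr1 ?addr0 ?add0r.
rewrite hE.
have -> : f (x + h 0 1 *: delta_mx 0 1 + h 0 0 *: delta_mx 0 0) - f x =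
  h 0 0 * partial 0 f (s *: delta_mx 0 0 + h 0 1 *: delta_mx 0 1 + x) +
  h 0 1 * partial 1 f (t *: delta_mx 0 1 + x).
  rewrite -(subrKA (f (x + h 0 1 *: delta_mx 0 1))) Es Et; congr (_ * _ + _ * _).
    by rewrite /partial [in RHS]addrC addrA addrAC.
  by rewrite /partial [in RHS]addrC.
rewrite opprD addrACA -!mulrBr (le_trans (ler_normD _ _))//.
have -> : e * `|h| = `|h| * (e / 2) + `|h| * (e / 2) by field.
rewrite !normrM lerD// ler_pM//.
- exact: norm_coord_le.
- apply: Hd; apply: le_lt_trans hd.
  rewrite [leLHS]/Num.Def.normr/= mx_normrE bigmax_le//= => -[a b] _ /=.
  rewrite !mxE ord1 eqxx /=.
  case: (@ord2_case 0 1 b) => // ->; rewrite !eqxx/= mulr0 mulr1 ?addr0 ?add0r.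
    by rewrite (le_trans sh)// norm_coord_le.
  exact: norm_coord_le.
- exact: norm_coord_le.
- apply: Hd'; apply: le_lt_trans hd'.
  rewrite normrZ (le_trans (ler_pM _ _ th (norm_delta_mx _)))//.
  by rewrite mulr1 norm_coord_le.
Qed.

End MeanValue.

(** * Symmetry of second derivatives *)

Section Schwarz.
Context {R : realType}.
Implicit Types (f g : 'rV[R]_2 -> R^o) (x v : 'rV[R]_2) (i j : 'I_2).

Lemma smooth_derivable f z v : smooth f -> derivable f z v.
Proof. by move=> sf; apply/diff_derivable/smooth_differentiable. Qed.

Lemma is_derive_translate f (a z v : 'rV[R]_2) : derivable f (z + a) v ->
  is_derive z v (fun y => f (y + a) : R^o) ('D_v f (z + a)).
Proof.
have E : (fun h : R => h^-1 *: (f (h *: v + z + a) - f (z + a))) =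
         (fun h : R => h^-1 *: (f (h *: v + (z + a)) - f (z + a))).
  by apply/funext => h; rewrite addrA.
by move=> df; apply: DeriveDef; rewrite /derivable /derive /= E.
Qed.

(** The mean value theorem is applied once along each side. Since the left-hand side is
symmetric in the two directions, so is, in the limit, the mixed derivative. *)
Lemma second_difference f x i j (h k : R) : smooth f ->
  exists2 z, `|z - x| <= `|h| + `|k| &
    f (x + h *: delta_mx 0 i + k *: delta_mx 0 j) - f (x + h *: delta_mx 0 i) -
    (f (x + k *: delta_mx 0 j) - f x) = h * (k * partial j (partial i f) z).
Proof.
move=> sf.
pose F (z : 'rV[R]_2) : R^o := f (z + k *: delta_mx 0 j) - f z.
have dF z v : is_derive z v F ('D_v f (z + k *: delta_mx 0 j) - 'D_v f z).
  apply: is_deriveB; first exact/is_derive_translate/smooth_derivable.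
  exact/derivableP/smooth_derivable.
have [t th Et] := mean_value x (v := delta_mx 0 i) h
  (fun z => @ex_derive _ _ _ _ _ _ _ (dF z _)).
rewrite (@derive_val _ _ _ _ _ _ _ (dF _ _)) in Et.
have [s sk Es] := mean_value (x + t *: delta_mx 0 i) (v := delta_mx 0 j) k
   (fun z => @smooth_derivable _ z _ (smooth_partial i sf)).
exists (x + t *: delta_mx 0 i + s *: delta_mx 0 j).
  rewrite -[x + _ + _]addrA [_ - x]addrC addKr (le_trans (ler_normD _ _))// !normrZ.
  by rewrite lerD// -[leRHS]mulr1 ler_pM// norm_delta_mx.
by move: Et; rewrite /F -/(partial i f _) -/(partial i f _) Es.
Qed.

Lemma continuous_eq_nearby (P Q : 'rV[R]_2 -> R^o) x :
  continuous P -> continuous Q ->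
  (forall h : R, 0 < h -> exists z z',
    [/\ `|z - x| <= h + h, `|z' - x| <= h + h & P z = Q z']) -> P x = Q x.
Proof.
move=> cP cQ PQ; apply/eqP; rewrite -subr_eq0 -normr_le0.
apply/ler_addgt0Pr => e e0; rewrite add0r.
have e20 : 0 < e / 2 by rewrite divr_gt0.
have near_x (F : 'rV[R]_2 -> R^o) : continuous F -> exists2 d : R, 0 < d &
    forall z, `|z - x| < d -> `|F x - F z| <= e / 2.
  move=> /(_ x)/cvgrPdist_le/(_ _ e20)/nbhs_ballP[d d0 Hd].
  by exists d => // z zd; apply: Hd; rewrite -ball_normE/= distrC.
have [d d0 Hd] := near_x P cP; have [d' d'0 Hd'] := near_x Q cQ.
pose h := Num.min d d' / 3.
have h0 : 0 < h by rewrite divr_gt0// lt_min d0 d'0.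
have [hd hd'] : h + h < d /\ h + h < d'.
  have : h * 3 <= d /\ h * 3 <= d'.
    by rewrite !divfK// !ge_min !lexx orbT.
  by lra.
have [z [z' [zx z'x Ez]]] := PQ h h0.
rewrite -(subrKA (P z)) (le_trans (ler_normD _ _))// [leRHS]splitr lerD//.
  by rewrite Hd// (le_lt_trans zx).
by rewrite Ez distrC Hd'// (le_lt_trans z'x).
Qed.

Lemma partialC f i j x : smooth f ->
  partial j (partial i f) x = partial i (partial j f) x.
Proof.
move=> sf; apply: continuous_eq_nearby => [||h h0].
- exact/smooth_continuous/smooth_partial/smooth_partial.
- exact/smooth_continuous/smooth_partial/smooth_partial.
have [z zx Ez] := second_difference x i j h h sf.
have [z' z'x Ez'] := second_difference x j i h h sf.
rewrite gtr0_norm// in zx z'x.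
exists z, z'; split; [exact: zx|exact: z'x|].
move: (partial j _ z) (partial i _ z') Ez Ez' => a b Ez Ez'.
have h_neq0 : h != 0 by rewrite gt_eqF.
apply: (mulfI h_neq0); apply: (mulfI h_neq0); rewrite -Ez -Ez'.
by rewrite [x + _ + _]addrAC; ring.
Qed.

End Schwarz.

Lemma grad_row2 (R : realType) (g1 g2 : 'rV[R]_2 -> R^o) (x : 'rV[R]_2) k l :
  smooth g1 -> smooth g2 ->
  grad (fun z => row2 (g1 z) (g2 z)) x k l = partial l (if k == 0 then g1 else g2) x.
Proof.
move=> s1 s2.
have coordE k' : (fun z => row2 (g1 z) (g2 z) 0 k' : R^o) =
    if k' == 0 then g1 else g2.
  by apply/funext => z; rewrite mxE; case: ifP.
have dg : derivable (fun z => row2 (g1 z) (g2 z)) x (delta_mx 0 l).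
  apply/derivable_mxP => a b; rewrite ord1 coordE.
  by case: ifP => _; exact: smooth_derivable.
rewrite mxE /partial (derive_mx dg) mxE.
by rewrite coordE.
Qed.

(** * Integrals over the unit interval depending on a parameter *)

Section UnitIntervalIntegral.
Context {R : realType}.
Implicit Types (f g : R -> R).

Definition int01 f : R :=
  \int[@lebesgue_measure R]_(t in [set` `[0, 1]]) f t.

Let measurable01 : measurable ([set` `[0, 1]] : set (measurableTypeR R)).
Proof. exact: measurable_itv. Qed.

Lemma continuous_integrable01 f : continuous f ->
  (@lebesgue_measure R).-integrable [set` `[0, 1]] (EFin \o f).
Proof.
move=> cf; apply: continuous_compact_integrable; first exact: segment_compact.
exact: continuous_subspaceT.
Qed.

Lemma int01D f g : continuous f -> continuous g ->
  int01 (fun t => f t + g t) = int01 f + int01 g.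
Proof. by move=> cf cg; rewrite /int01 RintegralD//; exact: continuous_integrable01. Qed.

Lemma int01B f g : continuous f -> continuous g ->
  int01 (fun t => f t - g t) = int01 f - int01 g.
Proof. by move=> cf cg; rewrite /int01 RintegralB//; exact: continuous_integrable01. Qed.

Lemma int01Z (c : R) f : continuous f -> int01 (fun t => c * f t) = c * int01 f.
Proof. by move=> cf; rewrite /int01 RintegralZl//; exact: continuous_integrable01. Qed.

Lemma int01_cst (c : R) : int01 (fun=> c) = c.
Proof.
rewrite /int01 Rintegral_cst//= lebesgue_measure_itv/= lte_fin ltr01.
by rewrite -EFinB subr0/= mulr1.
Qed.

Lemma eq_int01 f g : (forall t, 0 <= t <= 1 -> f t = g t) -> int01 f = int01 g.
Proof.
move=> fg; apply: eq_Rintegral => t; rewrite inE/= in_itv/= => t01.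
exact: fg.
Qed.

Lemma int01_norm_le f (e : R) : continuous f ->
  (forall t, 0 <= t <= 1 -> `|f t| <= e) -> `|int01 f| <= e.
Proof.
move=> cf fe; have ci := continuous_integrable01.
rewrite (le_trans (le_normr_Rintegral _ _))//; first exact: ci.
rewrite -[leRHS]int01_cst; apply: le_Rintegral => //.
- by apply: ci => t; apply: continuous_comp; [exact: cf|exact: norm_continuous].
- exact: (continuous_integrable01 (@cst_continuous R R e)).
Qed.

Lemma int01_lin3 (a b c : R) (f g h : R -> R) :
  continuous f -> continuous g -> continuous h ->
  int01 (fun t => a * f t + b * g t + c * h t) =
  a * int01 f + b * int01 g + c * int01 h.
Proof.
move=> cf cg ch.
have cZ (d : R) (k : R -> R) : continuous k -> continuous (fun t => d * k t).
  by move=> ck t; apply: cvgMl_tmp; exact: ck.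
have cab : continuous (fun t => a * f t + b * g t).
  by move=> t; apply: cvgD; exact: cZ.
rewrite (int01D cab (cZ c h ch)) (int01D (cZ a f cf) (cZ b g cg)).
by rewrite (int01Z a cf) (int01Z b cg) (int01Z c ch).
Qed.

Lemma int01_FTC f F : continuous f ->
  (forall t : R, is_derive t 1 F (f t)) -> int01 f = F 1 - F 0.
Proof.
move=> cf dF.
have cF : continuous F.
  by move=> t; apply: differentiable_continuous; apply/derivable1_diffP.
rewrite /int01 /Rintegral (@continuous_FTC2 _ f F)//.
- exact: continuous_subspaceT.
- split; first by [].
  + by apply: cvg_at_right_filter; exact: cF.
  + by apply: cvg_at_left_filter; exact: cF.
- by move=> t _; rewrite derive1E derive_val.
Qed.

End UnitIntervalIntegral.

Section ParameterIntegral.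
Context {R : realType}.
Implicit Types (F G : R -> 'rV[R]_2 -> R).

Definition jointly_continuous F := continuous (fun p : R * 'rV[R]_2 => F p.1 p.2).

Lemma jointly_continuous1 F y : jointly_continuous F -> continuous (F^~ y).
Proof.
move=> cF t; apply: (@continuous_comp _ _ _ (fun t : R => (t, y))
  (fun p : R * 'rV[R]_2 => F p.1 p.2)); last exact: cF.
by apply: (@cvg_pair _ _ _ _ (nbhs t) (nbhs y)); [exact: cvg_id|exact: cvg_cst].
Qed.

Lemma jointly_continuous_lin3 (a b c : 'rV[R]_2 -> R) F G (H : R -> 'rV[R]_2 -> R) :
  continuous a -> continuous b -> continuous c ->
  jointly_continuous F -> jointly_continuous G -> jointly_continuous H ->
  jointly_continuous (fun t y => a y * F t y + b y * G t y + c y * H t y).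
Proof.
have c2 (d : 'rV[R]_2 -> R) : continuous d ->
    continuous (fun p : R * 'rV[R]_2 => d p.2).
  by move=> cd p; apply: continuous_comp; [exact: cvg_snd|exact: cd].
move=> /c2 ca /c2 cb /c2 cc cF cG cH p.
apply: cvgD; first apply: cvgD.
- by apply: cvgM; [exact: ca|exact: cF].
- by apply: cvgM; [exact: cb|exact: cG].
- by apply: cvgM; [exact: cc|exact: cH].
Qed.

(** The unit interval being compact, continuity is uniform in the parameter. *)
Lemma jointly_continuous_uniform F x (e : R) : jointly_continuous F -> 0 < e ->
  \forall y \near x, forall t, 0 <= t <= 1 -> `|F t y - F t x| <= e.
Proof.
move=> cF e0; have e20 : 0 < e / 2 by rewrite divr_gt0.
have cpt : compact [set` `[0 : R, 1]] by exact: segment_compact.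
have near t : [set` `[0 : R, 1]] t ->
    \forall t' \near t & y \near x, `|F t' y - F t' x| <= e.
  move=> _; have /cvgrPdist_le/(_ _ e20) := cF (t, x).
case=> -[A B] [/= At Bx] AB.
exists (A, B) => //= -[s y] [/= As By].
rewrite -(subrKA (F t x)) (le_trans (ler_normD _ _))// [leRHS]splitr lerD//.
  by rewrite distrC; exact: (AB (s, y)).
by apply: (AB (s, x)); split => //; exact: nbhs_singleton Bx.
have cover := (compact_near_coveringP _).1 cpt _ (nbhs x)
  (fun y t => `|F t y - F t x| <= e) (nbhs_filter x) near.
by apply: filterS cover => y Hy t t01; apply: Hy; rewrite /= in_itv.
Qed.

Lemma continuous_int01 F : jointly_continuous F ->
  continuous (fun x => int01 (F^~ x) : R^o).
Proof.
move=> cF x; apply/(@cvgrPdist_le _ _ _ (nbhs x) (nbhs_filter x)) => e e0.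
have near_x := jointly_continuous_uniform x cF e0.
apply: (@filterS _ (nbhs x) (nbhs_filter x) _ _ _ near_x) => y Hy.
rewrite distrC -int01B; [|exact: jointly_continuous1..].
apply: int01_norm_le => // t.
by apply: continuousB; exact: jointly_continuous1.
Qed.

(** By the mean value theorem the difference quotients of the integrands converge
to their derivatives uniformly in the integration variable. *)
Lemma is_derive_int01 F G x v :
  (forall t y, is_derive (y : 'rV[R]_2) v (F t : _ -> R^o) (G t y)) ->
  jointly_continuous F -> jointly_continuous G ->
  is_derive x v (fun y => int01 (F^~ y) : R^o) (int01 (G^~ x)).
Proof.
move=> dF cF cG.
have lim : h^-1 *: (int01 (F^~ (h *: v + x)) - int01 (F^~ x) : R^o)
    @[h --> 0^'] --> (int01 (G^~ x) : R^o).
  apply/cvgrPdist_le => e e0.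
  have near0 : \forall h \near (0 : R)^', forall s, `|s| <= `|h| ->
      forall t, 0 <= t <= 1 -> `|G t (x + s *: v) - G t x| <= e.
    have /nbhs_ballP[d d0 Hd] := jointly_continuous_uniform x cG e0.
    have dv0 : 0 < d / (`|v| + 1) by rewrite divr_gt0// ltr_wpDl.
    apply: filterS (dnbhs0_lt (V := R) dv0) => h hd s sh t t01.
    apply: Hd => //; rewrite -ball_normE/= opprD addNKr normrN normrZ.
    move: hd; rewrite ltr_pdivlMr ?ltr_wpDl// => hd.
    apply: le_lt_trans hd; apply: ler_pM => //.
    by rewrite lerDl.
  have neq0 : \forall h \near (0 : R)^', h != 0 by exact: nbhs_dnbhs_neq.
  apply: filterS2 near0 neq0 => h Hh h0.
  have c1 (y : 'rV[R]_2) : continuous (F^~ y) by exact: jointly_continuous1.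
  have cB : continuous (fun t => F t (h *: v + x) - F t x).
    by move=> t; apply: continuousB; exact: c1.
  rewrite -int01B// -[_ *: _]int01Z// distrC -int01B; first last.
  - exact: jointly_continuous1.
  - by move=> t; apply: cvgMl_tmp; exact: cB.
  apply: int01_norm_le.
    move=> t; apply: cvgB; last exact: jointly_continuous1.
    by apply: cvgMl_tmp; exact: cB.
  move=> t t01.
  have [s sh Es] := @mean_value R (F t) x v h (fun y => @ex_derive _ _ _ _ _ _ _ (dF t y)).
  rewrite (@derive_val _ _ _ _ _ _ _ (dF _ _)) in Es.
  by rewrite [h *: v + x]addrC Es mulKf//; exact: Hh.
apply: DeriveDef; last exact: cvg_lim lim.
by apply/cvg_ex; exists (int01 (G^~ x)).
Qed.

End ParameterIntegral.

(** * Integrals along lines of variable slope *)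

Section LineIntegral.
Context {R : realType} (i j : 'I_2) (ij : i != j) (m : 'rV[R]_2 -> R^o).
Hypothesis smooth_m : smooth m.
Implicit Types (f g : 'rV[R]_2 -> R^o) (x v : 'rV[R]_2) (n : nat) (t : R).

Let neq_ji : (j == i) = false. Proof. by rewrite eq_sym; exact: negbTE. Qed.

(** The point of parameter [t] on the line of slope [m x] through [x]: the parameter is
[1] at [x] and [0] where the line crosses the axis on which the coordinate i
vanishes. With these bounds the integrals below run over a fixed interval. *)
Definition line_point t x : 'rV[R]_2 :=
  (t * x 0 i) *: delta_mx 0 i +
  (x 0 j + (t - 1) * (x 0 i * m x)) *: delta_mx 0 j.

Lemma line_point_i t x : line_point t x 0 i = t * x 0 i.
Proof. by rewrite !mxE !eqxx/= (negbTE ij) mulr1 mulr0 addr0. Qed.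

Lemma line_point_j t x : line_point t x 0 j = x 0 j + (t - 1) * (x 0 i * m x).
Proof. by rewrite !mxE !eqxx/= neq_ji mulr1 mulr0 add0r. Qed.

Lemma line_point1 x : line_point 1 x = x.
Proof.
apply/rowP => k; case: (ord2_case k ij) => ->.
  by rewrite line_point_i mul1r.
by rewrite line_point_j subrr mul0r addr0.
Qed.

Lemma line_point_affine t x : line_point t x =
  line_point 0 x + t *: (x 0 i *: (delta_mx 0 i + m x *: delta_mx 0 j)).
Proof.
apply/rowP => k; rewrite !mxE; ring.
Qed.

Lemma differentiable_line_point t x : differentiable (line_point t) x.
Proof.
have dX : differentiable (fun y : 'rV[R]_2 => t * y 0 i : R^o) x.
  apply: smooth_differentiable.
  by apply: smoothM; [exact: smooth_cst|exact: smooth_coord].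
have dY : differentiable
    (fun y : 'rV[R]_2 => y 0 j + (t - 1) * (y 0 i * m y) : R^o) x.
  apply: smooth_differentiable.
  apply: smoothD; first exact: smooth_coord.
  apply: smoothM; first exact: smooth_cst.
  by apply: smoothM => //; exact: smooth_coord.
by apply: differentiableD; exact: differentiableZl.
Qed.

Lemma derive_comp f t x v : smooth f ->
  is_derive x v (fun y => f (line_point t y) : R^o)
   ('D_('D_v (line_point t) x) f (line_point t x)).
Proof.
move=> sf; have dl := differentiable_line_point t x.
have df := smooth_differentiable (line_point t x) sf.
have dc : differentiable (fun y => f (line_point t y) : R^o) x.
  exact: (@differentiable_comp _ _ _ _ (line_point t) f).
apply: DeriveDef; first exact: diff_derivable.
rewrite (deriveE _ dc) (deriveE _ df) (deriveE _ dl).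
by rewrite [LHS](congr1 (@^~ v) (diff_comp dl df)).
Qed.

Let slope_arm : 'rV[R]_2 -> R^o := fun z => z 0 i * m z.

Let smooth_slope_arm : smooth slope_arm.
Proof. by apply: smoothM => //; exact: smooth_coord. Qed.

Lemma partial_line f t x k : smooth f ->
  partial k (fun y => f (line_point t y) : R^o) x =
  t * (k == i)%:R * partial i f (line_point t x) +
  ((k == j)%:R + (t - 1) * partial k slope_arm x) *
    partial j f (line_point t x).
Proof.
move=> sf; rewrite /partial (@derive_val _ _ _ _ _ _ _ (derive_comp t x _ sf)).
rewrite derive_partials; last exact: smooth_differentiable.
rewrite (big_ord2 _ ij) -/(partial _ _ _) -/(partial k slope_arm x).
have coordE l : ('D_(delta_mx 0 k) (line_point t) x) 0 l =
    partial k (fun y => line_point t y 0 l : R^o) x.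
  rewrite partial_entry; first by [].
    exact: differentiable_line_point.
congr (_ * _ + _ * _); rewrite coordE.
  rewrite (_ : (fun y => _) = fun y : 'rV[R]_2 => t * y 0 i : R^o); last first.
    by apply/funext => y; rewrite line_point_i.
  rewrite partialZ; last exact/smooth_differentiable/smooth_coord.
  by rewrite partial_coord.
rewrite (_ : (fun y => _) =
    fun y : 'rV[R]_2 => y 0 j + (t - 1) * slope_arm y : R^o); last first.
  by apply/funext => y; rewrite line_point_j.
rewrite partialD ?partialZ ?partial_coord//; apply: smooth_differentiable => //.
- exact: smooth_coord.
- by apply: smoothM => //; exact: smooth_cst.
Qed.

Definition line_int n f x : R := int01 (fun t => t ^+ n * f (line_point t x)).

Lemma continuous_line_point :
  continuous (fun p : R * 'rV[R]_2 => line_point p.1 p.2).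
Proof.
have c1 : continuous (fun p : R * 'rV[R]_2 => p.1) by move=> p; exact: cvg_fst.
have c2 (f : 'rV[R]_2 -> R^o) : continuous f ->
    continuous (fun p : R * 'rV[R]_2 => f p.2 : R^o).
  by move=> cf p; apply: continuous_comp; [exact: cvg_snd|exact: cf].
have cX := c2 _ (smooth_continuous (smooth_coord i)).
have cY := c2 _ (smooth_continuous (smooth_coord j)).
have cm := c2 _ (smooth_continuous smooth_m).
move=> p; apply: cvgD; apply: cvgZr_tmp.
  by apply: cvgM; [exact: c1|exact: cX].
apply: cvgD; first exact: cY.
apply: cvgM; first by apply: cvgB; [exact: c1|exact: cvg_cst].
by apply: cvgM; [exact: cX|exact: cm].
Qed.

Lemma jointly_continuous_line n f : continuous f ->
  jointly_continuous (fun t x => t ^+ n * f (line_point t x)).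
Proof.
move=> cf p; apply: cvgM.
  by apply: (@continuous_comp _ _ _ fst (fun t : R => t ^+ n));
    [exact: cvg_fst|exact: exprn_continuous].
by apply: (@continuous_comp _ _ _
  (fun p : R * 'rV[R]_2 => line_point p.1 p.2) f);
  [exact: continuous_line_point|exact: cf].
Qed.

Lemma continuous_line n f x : continuous f ->
  continuous ((fun t => t ^+ n * f (line_point t x)) : R -> R).
Proof.
move=> cf.
exact: (@jointly_continuous1 _ (fun t x => t ^+ n * f (line_point t x)) x
  (@jointly_continuous_line n f cf)).
Qed.

(** Moving [x] moves the points of the line, partly in proportion to [t]; this is why the
powers of [t] are carried along. *)
Lemma is_derive_line_int n f x k : smooth f ->
  is_derive x (delta_mx 0 k) (line_int n f : _ -> R^o)
   ((k == i)%:R * line_int n.+1 (partial i f) x +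
    ((k == j)%:R - partial k slope_arm x) * line_int n (partial j f) x +
    partial k slope_arm x * line_int n.+1 (partial j f) x).
Proof.
move=> sf.
have cfi : continuous (partial i f) by exact/smooth_continuous/smooth_partial.
have cfj : continuous (partial j f) by exact/smooth_continuous/smooth_partial.
have cq : continuous (partial k slope_arm).
  exact/smooth_continuous/smooth_partial.
have cr : continuous (fun y => (k == j)%:R - partial k slope_arm y).
  exact: (smooth_continuous (smoothB (smooth_cst _) (smooth_partial k smooth_slope_arm))).
have ce : continuous (fun _ : 'rV[R]_2 => (k == i)%:R : R).
  exact: cst_continuous.
have := jointly_continuous_lin3 ce cr cq
  (@jointly_continuous_line n.+1 _ cfi) (@jointly_continuous_line n _ cfj)
  (@jointly_continuous_line n.+1 _ cfj).
rewrite /= => cG.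
pose G t y := (k == i)%:R * (t ^+ n.+1 * partial i f (line_point t y)) +
   ((k == j)%:R - partial k slope_arm y) *
      (t ^+ n * partial j f (line_point t y)) +
   partial k slope_arm y * (t ^+ n.+1 * partial j f (line_point t y)).
have dF t y : is_derive y (delta_mx 0 k)
    (fun y => t ^+ n * f (line_point t y) : R^o) (G t y).
  have -> : G t y = t ^+ n * partial k (fun y => f (line_point t y) : R^o) y.
    rewrite partial_line// /G exprS.
    move: (partial i f _) (partial j f _) (partial k _ y) => a b c; ring.
  have dfl : derivable (fun y => f (line_point t y) : R^o) y (delta_mx 0 k).
    by have [] := derive_comp t y (delta_mx 0 k) sf.
  exact: (is_deriveZ (t ^+ n) (derivableP dfl)).
have cF := @jointly_continuous_line n f (smooth_continuous sf).
have := @is_derive_int01 _ _ G x _ dF cF cG.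
rewrite /G (int01_lin3 _ _ _ (@continuous_line n.+1 _ x cfi)
  (@continuous_line n _ x cfj) (@continuous_line n.+1 _ x cfj)).
exact.
Qed.

Lemma of_class_C_line_int k n f : smooth f ->
  of_class_C k (line_int n f : _ -> R^o).
Proof.
elim: k n f => [|k IH] n f sf.
  exact/continuous_int01/jointly_continuous_line/smooth_continuous.
have partialE l : partial l (line_int n f : _ -> R^o) = fun x =>
    (l == i)%:R * line_int n.+1 (partial i f) x +
    ((l == j)%:R - partial l slope_arm x) * line_int n (partial j f) x +
    partial l slope_arm x * line_int n.+1 (partial j f) x : R^o.
  apply/funext => x.
  exact: (@derive_val _ _ _ _ _ _ _ (is_derive_line_int n x l sf)).
have Cp l : of_class_C k (partial l (line_int n f : _ -> R^o)).
  rewrite partialE.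
  have sq := smooth_partial l smooth_slope_arm.
  apply: of_class_CD; [apply: of_class_CD|]; apply: of_class_CM.
  - exact: of_class_C_cst.
  - by apply: IH; exact: smooth_partial.
  - by apply: of_class_CB; [exact: of_class_C_cst|exact: sq].
  - by apply: IH; exact: smooth_partial.
  - exact: sq.
  - by apply: IH; exact: smooth_partial.
apply/of_class_CSP; split => //; apply: differentiable_C1 => [x l|l].
  by have := is_derive_line_int n x l sf.
exact: of_class_C_continuous (Cp l).
Qed.

Lemma smooth_line_int n f : smooth f -> smooth (line_int n f : _ -> R^o).
Proof. by move=> sf k; exact: of_class_C_line_int. Qed.

(** Integration by parts along the line: the derivative of [f] in the direction
of the line is a derivative in the parameter [t]. *)
Lemma line_int_parts n f x : smooth f ->
  x 0 i * (line_int n.+1 (partial i f) x + m x * line_int n.+1 (partial j f) x) =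
  f x - n.+1%:R * line_int n f x.
Proof.
move=> sf.
have cfi : continuous (partial i f) by exact/smooth_continuous/smooth_partial.
have cfj : continuous (partial j f) by exact/smooth_continuous/smooth_partial.
have cf : continuous f by exact: smooth_continuous.
pose w : 'rV[R]_2 := x 0 i *: (delta_mx 0 i + m x *: delta_mx 0 j).
pose F (t : R) : R := t ^+ n.+1 * f (line_point t x).
pose dF (t : R) : R := x 0 i * (t ^+ n.+1 * partial i f (line_point t x)) +
  x 0 i * m x * (t ^+ n.+1 * partial j f (line_point t x)) +
  n.+1%:R * (t ^+ n * f (line_point t x)).
have cF1 := @continuous_line n.+1 _ x cfi.
have cF2 := @continuous_line n.+1 _ x cfj.
have cF3 := @continuous_line n _ x cf.
have cdF : continuous dF.
  move=> t; apply: cvgD; [apply: cvgD|]; apply: cvgMl_tmp;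
    [exact: cF1|exact: cF2|exact: cF3].
have derF t : is_derive t 1 F (dF t).
  have dl : is_derive (t : R^o) (1 : R^o) (fun s : R^o => f (line_point s x))
      ('D_w f (line_point t x)).
    rewrite [line_point t x]line_point_affine.
    under eq_fun do rewrite line_point_affine.
    exact/is_derive_line/smooth_derivable.
  have dw : 'D_w f (line_point t x) = x 0 i * partial i f (line_point t x) +
      x 0 i * m x * partial j f (line_point t x).
    rewrite derive_partials; last exact: smooth_differentiable.
    by rewrite (big_ord2 _ ij) !mxE !eqxx/= neq_ji (negbTE ij)/= !mulr0 addr0
      add0r !mulr1.
  have dp : is_derive (t : R^o) (1 : R^o) (fun s : R^o => s ^+ n.+1 : R^o)
      (n.+1%:R * t ^+ n).
    by apply: DeriveDef; [exact: exprn_derivable|rewrite exp_derive scaler1].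
  have := is_deriveM dp dl; rewrite dw.
  suff -> : t ^+ n.+1 *: (x 0 i * partial i f (line_point t x) +
      x 0 i * m x * partial j f (line_point t x) : R^o) +
      f (line_point t x) *: (n.+1%:R * t ^+ n : R^o) = dF t by [].
  rewrite /dF /GRing.scale/=.
  move: (partial i f _) (partial j f _) (f _) => a b c; ring.
have := int01_FTC cdF derF.
rewrite /F line_point1 expr1n mul1r expr0n/= mul0r subr0 => <-.
rewrite /dF (int01_lin3 _ _ _ cF1 cF2 cF3) /line_int.
move: (int01 _) (int01 _) (int01 _) => a b c; ring.
Qed.

Lemma line_int_eq0 n f x :
  (forall t, f (line_point t x) = 0) -> line_int n f x = 0.
Proof.
move=> f0; rewrite /line_int -[RHS](int01_cst 0).
by apply: eq_int01 => t _; rewrite f0 mulr0.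
Qed.

End LineIntegral.

(** * Displacements with a prescribed strain along the rulings *)

(** The algebra behind [displacement_equations]. The letters [P], [Q] and [M] stand for
[pot] of an entry [a], [b] or [c] of the strain, for [pot] of its derivative and for
[moment] of its derivative; [s] is the slope, and a final i or j marks a partial
derivative. *)
Lemma displacement_algebra (R : realType)
    (a b c s si sj Pai Paj Pbi Pbj Pci Pcj Mai Maj Mbi Mbj Mci Mcj
     Qa Qb Qc Ma Mb Mc Pb Pc : R) :
  si + s * sj = 0 ->
  Paj = Qa + sj * Ma -> Pbj = Qb + sj * Mb -> Pcj = Qc + sj * Mc ->
  Pai + s * Paj = a -> Pbi + s * Pbj = b -> Pci + s * Pcj = c ->
  Mai + s * Maj = - Qa -> Mbi + s * Mbj = - Qb -> Mci + s * Mcj = - Qc ->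
  let along sk Pak Pbk Pck := Pak + 2 * (s * Pbk + Pb * sk) +
    (s * s * Pck + Pc * (2 * s * sk)) in
  let dj sk Pbk Pck Mak Mbk Mck := 2 * (Pbk + (s * Pck + Pc * sk)) +
    (Mak + 2 * (s * Mbk + Mb * sk) + (s * s * Mck + Mc * (2 * s * sk))) in
  let dj0 := 2 * (Pb + s * Pc) + (Ma + 2 * s * Mb + s * s * Mc) in
  let di sk Pak Pbk Pck Mak Mbk Mck := along sk Pak Pbk Pck -
    (s * dj sk Pbk Pck Mak Mbk Mck + dj0 * sk) in
  a = di si Pai Pbi Pci Mai Mbi Mci + (c - dj sj Pbj Pcj Maj Mbj Mcj) * (s * s) /\
  2 * b = di sj Paj Pbj Pcj Maj Mbj Mcj + dj si Pbi Pci Mai Mbi Mci -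
    2 * (c - dj sj Pbj Pcj Maj Mbj Mcj) * s.
Proof.
move=> Es EPa EPb EPc <- <- <- EMa EMb EMc along dj dj0 di.
rewrite /di /dj0 /dj /along.
have -> : si = - (s * sj) by apply/eqP; rewrite -addr_eq0 Es.
have -> : Mai = - Qa - s * Maj by rewrite -EMa addrK.
have -> : Mbi = - Qb - s * Mbj by rewrite -EMb addrK.
have -> : Mci = - Qc - s * Mcj by rewrite -EMc addrK.
by rewrite EPa EPb EPc; split; ring.
Qed.

Section LinePotentials.
Context {R : realType} (i j : 'I_2) (ij : i != j) (m : 'rV[R]_2 -> R^o).
Hypothesis smooth_m : smooth m.
Implicit Types (f g : 'rV[R]_2 -> R^o) (x : 'rV[R]_2).

(** The integral of [f] along the line of slope [m x], from the axis where the coordinate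
i vanishes to [x], the line being parametrised by that coordinate. *)
Definition pot f : 'rV[R]_2 -> R^o := fun x => x 0 i * line_int i j m 0 f x.

(** The derivative of [pot f] with respect to the slope is [moment] of the j-th partial
derivative of [f]: the weight [t - 1], times the coordinate i of [x], is the velocity of
the point of parameter [t] when the line turns around [x]. *)
Definition moment f : 'rV[R]_2 -> R^o :=
  fun x => x 0 i * x 0 i * (line_int i j m 1 f x - line_int i j m 0 f x).

Let sX : smooth (fun x : 'rV[R]_2 => x 0 i : R^o).
Proof. exact: smooth_coord. Qed.

Let sL n f : smooth f -> smooth (line_int i j m n f : _ -> R^o).
Proof. exact: smooth_line_int. Qed.

Lemma smooth_pot f : smooth f -> smooth (pot f).
Proof. by move=> sf; apply: smoothM => //; exact: sL. Qed.

Lemma smooth_moment f : smooth f -> smooth (moment f).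
Proof.
move=> sf; apply: smoothM; first exact: (smoothM sX sX).
by apply: smoothB; exact: sL.
Qed.

Lemma partial_line_int n f x k : smooth f ->
  partial k (line_int i j m n f : _ -> R^o) x =
  (k == i)%:R * line_int i j m n.+1 (partial i f) x +
  ((k == j)%:R - (x 0 i * partial k m x + m x * (k == i)%:R)) *
    line_int i j m n (partial j f) x +
  (x 0 i * partial k m x + m x * (k == i)%:R) *
    line_int i j m n.+1 (partial j f) x.
Proof.
move=> sf.
have := @derive_val _ _ _ _ _ _ _ (is_derive_line_int ij smooth_m n x k sf).
rewrite [partial k (fun z => z 0 i * m z) x]partialM; [|exact: smooth_differentiable..].
by rewrite partial_coord.
Qed.

Lemma partial_pot f x : smooth f ->
  partial j (pot f) x =
  pot (partial j f) x + partial j m x * moment (partial j f) x.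
Proof.
move=> sf; rewrite partialM; [|exact/smooth_differentiable|exact/smooth_differentiable/sL].
rewrite partial_coord partial_line_int// eqxx eq_sym (negbTE ij) /pot /moment.
move: (line_int i j m 1 (partial j f) x) (line_int i j m 1 (partial i f) x).
move: (line_int i j m 0 (partial j f) x) (line_int i j m 0 f x) (partial j m x).
by move=> a b c d e; rewrite /=; ring.
Qed.

Lemma partial_moment k f x : smooth f ->
  partial k (moment f) x =
  x 0 i * x 0 i * (partial k (line_int i j m 1 f : _ -> R^o) x -
                   partial k (line_int i j m 0 f : _ -> R^o) x) +
  (line_int i j m 1 f x - line_int i j m 0 f x) * (2 * x 0 i * (k == i)%:R).
Proof.
move=> sf.
have dX := smooth_differentiable x sX.
have dL n := smooth_differentiable x (sL n sf).
have dXX := smooth_differentiable x (smoothM sX sX).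
have dLL := smooth_differentiable x (smoothB (sL 1 sf) (sL 0 sf)).
rewrite /moment (partialM k dXX dLL) (partialM k dX dX).
rewrite (partialB k (dL 1%N) (dL 0%N)) partial_coord.
by congr (_ + _ * _); move: (x 0 i) ((k == i)%:R : R) => u w; ring.
Qed.

(** Where [m] satisfies the inviscid Burgers equation, it is stationary in the
direction [(1, m)], so that to first order a point moving in that direction stays on
its line: [pot] then behaves as an antiderivative. *)
Section AlongRuling.
Variable x : 'rV[R]_2.
Hypothesis burgers : partial i m x + m x * partial j m x = 0.

Let along h := partial i h x + m x * partial j h x.

Lemma along_line_int n f : smooth f ->
  along (line_int i j m n f : _ -> R^o) =
  line_int i j m n.+1 (partial i f) x + m x * line_int i j m n.+1 (partial j f) x.
Proof.
move=> sf; rewrite /along !partial_line_int// !eqxx [j == i]eq_sym (negbTE ij).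
have -> : partial i m x = - (m x * partial j m x) by apply/eqP; rewrite -addr_eq0 burgers.
move: (line_int i j m n.+1 (partial j f) x) (line_int i j m n.+1 (partial i f) x).
move: (line_int i j m n (partial j f) x) (partial j m x).
by move=> a b c d; rewrite /=; ring.
Qed.

Lemma along_pot f : smooth f -> along (pot f) = f x.
Proof.
move=> sf; have := line_int_parts ij smooth_m 0 x sf.
rewrite -along_line_int// /along /pot.
rewrite !partialM; try (exact/smooth_differentiable/sL || exact/smooth_differentiable/sX).
rewrite !partial_coord eqxx [j == i]eq_sym (negbTE ij).
move: (partial i (line_int i j m 0 f : _ -> R^o) x) => a.
move: (partial j (line_int i j m 0 f : _ -> R^o) x) => b.
move: (line_int i j m 0 f x) => c E.
have -> : f x = x 0 i * (a + m x * b) + 1 * c by rewrite E; ring.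
by rewrite /=; ring.
Qed.

Lemma along_moment f : smooth f -> along (moment f) = - pot f x.
Proof.
move=> sf; have E0 := line_int_parts ij smooth_m 0 x sf.
have E1 := line_int_parts ij smooth_m 1 x sf.
rewrite -(along_line_int 0 sf) in E0; rewrite -(along_line_int 1 sf) in E1.
move: E0 E1; rewrite /along !(partial_moment _ _ sf) eqxx [j == i]eq_sym (negbTE ij) /pot.
move: (partial i (line_int i j m 1 f : _ -> R^o) x) => a1.
move: (partial j (line_int i j m 1 f : _ -> R^o) x) => b1.
move: (partial i (line_int i j m 0 f : _ -> R^o) x) => a0.
move: (partial j (line_int i j m 0 f : _ -> R^o) x) => b0.
move: (line_int i j m 1 f x) (line_int i j m 0 f x) => c1 c0 E0 E1.
transitivity (2 * x 0 i * (c1 - c0) + x 0 i * (x 0 i * (a1 + m x * b1)) -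
  x 0 i * (x 0 i * (a0 + m x * b0))).
  by rewrite /=; ring.
by rewrite E1 E0; ring.
Qed.

End AlongRuling.

Section QuadraticCombination.
Variables a b c : 'rV[R]_2 -> R^o.
Hypotheses (sa : smooth a) (sb : smooth b) (sc : smooth c).

(** The value of a quadratic form with entries [a], [b], [c] on the vector of
coordinates [(1, m)]. *)
Definition quadratic : 'rV[R]_2 -> R^o :=
  fun x => a x + 2 * m x * b x + m x * m x * c x.

Let s2 : smooth ((fun=> 2) : 'rV[R]_2 -> R^o). Proof. exact: smooth_cst. Qed.
Let s2m : smooth (fun x => 2 * m x : R^o). Proof. exact: smoothM. Qed.
Let smm : smooth (fun x => m x * m x : R^o). Proof. exact: smoothM. Qed.
Let s2mb : smooth (fun x => 2 * m x * b x : R^o). Proof. exact: smoothM. Qed.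
Let smmc : smooth (fun x => m x * m x * c x : R^o). Proof. exact: smoothM. Qed.
Let sab : smooth (fun x => a x + 2 * m x * b x : R^o). Proof. exact: smoothD. Qed.

Lemma smooth_quadratic : smooth quadratic.
Proof. exact: smoothD. Qed.

Lemma partial_quadratic k x : partial k quadratic x =
  partial k a x + 2 * (m x * partial k b x + b x * partial k m x) +
  (m x * m x * partial k c x + c x * (2 * m x * partial k m x)).
Proof.
have d f (sf : smooth f) := smooth_differentiable x sf.
rewrite /quadratic (partialD k (d _ sab) (d _ smmc)) (partialD k (d _ sa) (d _ s2mb)).
rewrite (partialM k (d _ s2m) (d _ sb)) (partialM k (d _ smm) (d _ sc)).
rewrite (partialM k (d _ s2) (d _ smooth_m)) (partialM k (d _ smooth_m) (d _ smooth_m)).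
rewrite partial_cst.
move: (partial k a x) (partial k b x) (partial k c x) (partial k m x).
by move: (a x) (b x) (c x) (m x) => u v w s p q r t; ring.
Qed.

End QuadraticCombination.

Section Displacement.
Variables a b c : 'rV[R]_2 -> R^o.
Hypotheses (sa : smooth a) (sb : smooth b) (sc : smooth c).

(** The strain in the direction [(1, m)] does not feel a bending term proportional to
the Hessian, whose kernel is that direction: it can only be the derivative of the
component of the displacement along the ruling. *)
Definition displacement_along : 'rV[R]_2 -> R^o :=
  quadratic (pot a) (pot b) (pot c).

Let shear : 'rV[R]_2 -> R^o := fun x => 2 * (pot b x + m x * pot c x).

Let bend : 'rV[R]_2 -> R^o := quadratic (moment (partial j a))
  (moment (partial j b)) (moment (partial j c)).

(** This is the derivative of [displacement_along] with respect to the slope, the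
point being kept fixed. *)
Definition displacement_j : 'rV[R]_2 -> R^o :=
  fun x => 2 * (pot b x + m x * pot c x) + bend x.

Definition displacement_i : 'rV[R]_2 -> R^o :=
  fun x => displacement_along x - m x * displacement_j x.

Let sM f : smooth f -> smooth (moment (partial j f)).
Proof. by move=> sf; exact/smooth_moment/smooth_partial. Qed.
Let smc : smooth (fun x => m x * pot c x : R^o).
Proof. exact: (smoothM smooth_m (smooth_pot sc)). Qed.
Let sbc : smooth (fun x => pot b x + m x * pot c x : R^o).
Proof. exact: (smoothD (smooth_pot sb) smc). Qed.
Let s2 : smooth ((fun=> 2) : 'rV[R]_2 -> R^o). Proof. exact: smooth_cst. Qed.
Let sshear : smooth shear. Proof. exact: (smoothM s2 sbc). Qed.
Let sbend : smooth bend.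
Proof. exact: (smooth_quadratic (sM sa) (sM sb) (sM sc)). Qed.

Lemma smooth_displacement_along : smooth displacement_along.
Proof. exact: (smooth_quadratic (smooth_pot sa) (smooth_pot sb) (smooth_pot sc)). Qed.

Lemma smooth_displacement_j : smooth displacement_j.
Proof. exact: (smoothD sshear sbend). Qed.

Let smj : smooth (fun x => m x * displacement_j x : R^o).
Proof. exact: (smoothM smooth_m smooth_displacement_j). Qed.

Lemma smooth_displacement_i : smooth displacement_i.
Proof. exact: (smoothB smooth_displacement_along smj). Qed.

Lemma partial_displacement_along k x : partial k displacement_along x =
  partial k (pot a) x + 2 * (m x * partial k (pot b) x + pot b x * partial k m x) +
  (m x * m x * partial k (pot c) x + pot c x * (2 * m x * partial k m x)).
Proof. exact: (partial_quadratic (smooth_pot sa) (smooth_pot sb) (smooth_pot sc) k x). Qed.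

Lemma partial_displacement_j k x : partial k displacement_j x =
  2 * (partial k (pot b) x + (m x * partial k (pot c) x + pot c x * partial k m x)) +
  (partial k (moment (partial j a)) x +
  2 * (m x * partial k (moment (partial j b)) x + moment (partial j b) x * partial k m x) +
  (m x * m x * partial k (moment (partial j c)) x +
     moment (partial j c) x * (2 * m x * partial k m x))).
Proof.
have d f (sf : smooth f) := smooth_differentiable x sf.
rewrite /displacement_j (partialD k (d _ sshear) (d _ sbend)).
rewrite (partialZ k 2 (d _ sbc)) (partialD k (d _ (smooth_pot sb)) (d _ smc)).
rewrite (partialM k (d _ smooth_m) (d _ (smooth_pot sc))).
by rewrite (partial_quadratic (sM sa) (sM sb) (sM sc)).
Qed.

Lemma partial_displacement_i k x : partial k displacement_i x =
  partial k displacement_along x -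
    (m x * partial k displacement_j x + displacement_j x * partial k m x).
Proof.
have d f (sf : smooth f) := smooth_differentiable x sf.
rewrite /displacement_i (partialB k (d _ smooth_displacement_along) (d _ smj)).
by rewrite (partialM k (d _ smooth_m) (d _ smooth_displacement_j)).
Qed.

Variable x : 'rV[R]_2.
Hypothesis burgers : partial i m x + m x * partial j m x = 0.

(** The equation (j, j) is met by taking [c x - partial j displacement_j x] as the
coefficient of the matrix [(m ^ 2, - m, 1)], to which the Hessian is proportional; then
the two other equations hold as well. *)
Lemma displacement_equations :
  a x = partial i displacement_i x + (c x - partial j displacement_j x) * (m x * m x) /\
  2 * b x = partial j displacement_i x + partial i displacement_j x -
    2 * (c x - partial j displacement_j x) * m x.
Proof.
rewrite !partial_displacement_i !partial_displacement_along !partial_displacement_j.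
exact: (displacement_algebra (pot b x) (pot c x) burgers (partial_pot x sa) (partial_pot x sb)
  (partial_pot x sc) (along_pot burgers sa) (along_pot burgers sb)
  (along_pot burgers sc) (along_moment burgers (smooth_partial j sa))
  (along_moment burgers (smooth_partial j sb))
  (along_moment burgers (smooth_partial j sc))).
Qed.

End Displacement.

Lemma pot_eq0 f x : (forall t, f (line_point i j m t x) = 0) -> pot f x = 0.
Proof. by move=> f0; rewrite /pot line_int_eq0// mulr0. Qed.

Lemma moment_eq0 f x : (forall t, f (line_point i j m t x) = 0) -> moment f x = 0.
Proof. by move=> f0; rewrite /moment !line_int_eq0// subr0 mulr0. Qed.

End LinePotentials.

(** * A flat function *)

Section FlatFunction.
Context {R : realType}.
Implicit Types (t : R) (n : nat).

(** The family is closed under differentiation, up to linear combinations, which makes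
the smoothness of [flat 0] provable by induction. *)
Definition flat n t : R := if 0 < t then t^-1 ^+ n * expR (- t^-1) else 0.

Lemma flat_ge0 n t : 0 <= flat n t.
Proof.
rewrite /flat; case: ifP => // t0.
by rewrite mulr_ge0// ?expR_ge0// exprn_ge0// invr_ge0 ltW.
Qed.

Lemma flat_gt0 n t : 0 < t -> 0 < flat n t.
Proof. by move=> t0; rewrite /flat t0 mulr_gt0 ?expR_gt0// exprn_gt0// invr_gt0. Qed.

Lemma flat_eq0 n t : t <= 0 -> flat n t = 0.
Proof. by rewrite /flat ltNge => ->. Qed.

(** All the functions [flat n] are dominated by [t ^ 2] at the origin, which makes
them differentiable there with a zero derivative. *)
Lemma flat_le n t : flat n t <= (n.+2)`!%:R * t ^+ 2.
Proof.
have [t0|t0] := ltP 0 t; last first.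
  by rewrite flat_eq0// mulr_ge0// ?ler0n// sqr_ge0.
rewrite /flat t0; set y := t^-1.
have y0 : 0 < y by rewrite invr_gt0.
have : y ^+ n.+2 / n.+2`!%:R <= expR y.
  by rewrite (le_trans _ (expR_ge1Dxn n.+1 (ltW y0)))// lerDr.
rewrite ler_pdivrMr ?ltr0n ?fact_gt0// expRN => ey.
rewrite ler_pdivrMr ?expR_gt0// mulrAC -ler_pdivrMr ?exprn_gt0//.
by rewrite -exprVn -/y -exprD addn2 mulrC.
Qed.

Lemma is_derive_flat0 n : is_derive (0 : R) 1 (flat n) 0.
Proof.
have lim : h^-1 *: (flat n (h *: 1 + 0) - flat n 0) @[h --> (0 : R)^'] --> (0 : R).
  apply/cvgrPdist_le => e e0.
  have C0 : 0 < (n.+2)`!%:R :> R by rewrite ltr0n fact_gt0.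
  have d0 : 0 < e / (n.+2)`!%:R by rewrite divr_gt0.
  have near1 := dnbhs0_lt (V := R) d0.
  have near2 : \forall h \near (0 : R)^', h != 0 by exact: nbhs_dnbhs_neq.
  apply: filterS2 near1 near2 => h hd h0.
  rewrite (@flat_eq0 _ 0)// subr0 sub0r normrN normrZ normfV.
  rewrite addr0 [h *: 1]mulr1 (ger0_norm (flat_ge0 _ _)).
  rewrite ler_pdivrMl ?normr_gt0//.
  rewrite (le_trans (flat_le _ _))// -[h ^+ 2]real_normK ?num_real//.
  move: hd; rewrite ltr_pdivlMr// => hd.
  by rewrite expr2 mulrC -mulrA ler_wpM2l// ltW.
by apply: DeriveDef; [apply/cvg_ex; exists 0|exact: cvg_lim lim].
Qed.

Lemma is_derive_flat n t :
  is_derive t 1 (flat n) (flat n.+2 t - n%:R * flat n.+1 t).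
Proof.
have [t0|t0|<-] := ltgtP 0 t; last first.
- rewrite !flat_eq0// mulr0 subr0; exact: is_derive_flat0.
- rewrite !flat_eq0 ?ltW// mulr0 subr0.
  apply: (near_eq_is_derive (f := fun=> 0)) => //.
  by near=> s; rewrite flat_eq0//; apply: ltW; near: s; exact: lt_nbhsl.
apply: (near_eq_is_derive (f := (fun s => s^-1 ^+ n * expR (- s^-1)) : R -> R)).
  by near=> s; rewrite /flat ifT//; near: s; exact: lt_nbhsr.
have tn0 : t != 0 by rewrite gt_eqF.
have dV : is_derive t 1 (fun s : R => s^-1) (- (t^-1 ^+ 2)).
  apply: DeriveDef; first exact: derivableV.
  by rewrite deriveV// derive_id -exprVn scaler1.
have dp : is_derive (t^-1) 1 (fun s : R => s ^+ n) (n%:R * t^-1 ^+ n.-1).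
  by apply: DeriveDef; [exact: exprn_derivable|rewrite exp_derive scaler1].
have dX := @is_derive1_comp R (fun s => s ^+ n) (fun s : R => s^-1) t _ _ dp dV.
have dN := is_deriveN dV.
have dE : is_derive t 1 (fun s : R => expR (- s^-1)) (t^-1 ^+ 2 * expR (- t^-1)).
  have := @is_derive1_comp R expR (fun s : R => - s^-1) t _ _
    (is_derive_expR (- t^-1)) dN.
  by rewrite opprK mulrC; exact.
have dM := is_deriveM dX dE.
apply: (is_derive_eq dM).
rewrite /flat t0 /GRing.scale/=.
case: n {dp dX dM} => [|n].
  rewrite expr0 !mul0r; ring.
rewrite !exprS /=; ring.
Unshelve. all: by end_near. Qed.

End FlatFunction.

(** * Smooth cutoffs *)

Section Cutoffs.
Context {R : realType}.
Implicit Types (f g : 'rV[R]_2 -> R^o) (x : 'rV[R]_2) (n : nat) (K : set 'rV[R]_2).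

Lemma is_derive_flat_comp n f x v : differentiable f x ->
  is_derive x v (fun z => flat n (f z) : R^o)
    ((flat n.+2 (f x) - n%:R * flat n.+1 (f x)) * 'D_v f x).
Proof.
move=> df; have dn := is_derive_flat n (f x).
have dfl : differentiable (flat n : R^o -> R^o) (f x).
  by apply/derivable1_diffP.
have dc : differentiable (fun z => flat n (f z) : R^o) x.
  exact: (@differentiable_comp _ _ _ _ f (flat n : R^o -> R^o)).
apply: DeriveDef; first exact: diff_derivable.
rewrite (deriveE _ dc) [LHS](congr1 (@^~ v) (diff_comp df dfl)) (deriveE _ df).
rewrite /= -[in LHS](mulr1 ('d f x v)) linearZ /= -(deriveE _ dfl) mulrC.
by rewrite (@derive_val _ _ _ _ _ _ _ dn).
Qed.

Lemma of_class_C_flat k n f : smooth f ->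
  of_class_C k (fun z => flat n (f z) : R^o).
Proof.
elim: k n => [|k IH] n sf; last first.
  split=> [x|i].
    apply: (@differentiable_comp _ _ _ _ f (flat n : R^o -> R^o)).
      exact: smooth_differentiable.
    by apply/derivable1_diffP; have := is_derive_flat n (f x).
  rewrite (_ : partial _ _ = fun x =>
     (flat n.+2 (f x) - n%:R * flat n.+1 (f x)) * partial i f x : R^o).
    apply: of_class_CM; last exact/smooth_partial.
    apply: of_class_CB; first exact: IH.
    by apply: of_class_CM; [exact: of_class_C_cst|exact: IH].
  apply/funext => x; apply: (@derive_val _ _ _ _ _ _ _ _).
  exact/is_derive_flat_comp/smooth_differentiable.
move=> x; apply: (@continuous_comp _ _ _ f (flat n : R^o -> R^o)).
  exact: smooth_continuous.
apply: differentiable_continuous; apply/derivable1_diffP.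
by have := is_derive_flat n (f x).
Qed.

Lemma smooth_flat n f : smooth f -> smooth (fun z => flat n (f z) : R^o).
Proof. by move=> sf k; exact: of_class_C_flat. Qed.

(** At every [t], at least one of the two terms of the denominator is positive. *)
Definition step (t : R) : R := flat 0 t / (flat 0 t + flat 0 (1 - t)).

Lemma step_denominator (t : R) : flat 0 t + flat 0 (1 - t) != 0.
Proof.
have [t0|t0] := leP t 0; rewrite gt_eqF//.
  by rewrite ltr_wpDl ?flat_ge0// flat_gt0// subr_gt0 (le_lt_trans t0).
by rewrite ltr_pwDl ?flat_ge0// flat_gt0.
Qed.

Lemma step0 (t : R) : t <= 0 -> step t = 0.
Proof. by move=> t0; rewrite /step flat_eq0// mul0r. Qed.

Lemma step1 (t : R) : 1 <= t -> step t = 1.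
Proof.
move=> t1; have := step_denominator t.
by rewrite /step (@flat_eq0 _ _ (1 - t)) ?subr_le0// addr0 => t0; rewrite divff.
Qed.

Lemma smooth_step f : smooth f -> smooth (fun z => step (f z) : R^o).
Proof.
move=> sf; apply: smoothM; first exact: smooth_flat.
apply: smoothV => [z|]; first exact: step_denominator.
apply: smoothD; apply: smooth_flat => //.
by apply: smoothB => //; exact: smooth_cst.
Qed.

(** A smooth function on the whole line that agrees with the inverse away from
the interval [-c, c], so that dividing by a function which may vanish elsewhere
keeps everything smooth and globally defined. *)
Definition soft_inv (c t : R) : R := t / (t ^+ 2 + flat 0 (c ^+ 2 - t ^+ 2)).

Lemma soft_invE (c t : R) : 0 <= c -> c <= `|t| -> soft_inv c t = t^-1.
Proof.
move=> c0 ct; rewrite /soft_inv flat_eq0 ?addr0.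
  have [->|t0] := eqVneq t 0; first by rewrite mul0r invr0.
  by field.
by rewrite subr_le0 -[t ^+ 2]real_normK ?num_real// ler_sqr.
Qed.

Lemma soft_inv0 (c : R) : soft_inv c 0 = 0.
Proof. by rewrite /soft_inv mul0r. Qed.

Lemma smooth_soft_inv (c : R) f : 0 < c -> smooth f ->
  smooth (fun z => soft_inv c (f z) : R^o).
Proof.
move=> c0 sf; have sf2 : smooth (fun z => f z ^+ 2 : R^o) by exact: smoothM.
apply: smoothM => //; apply: smoothV => [z|].
  have [->|t0] := eqVneq (f z) 0.
    by rewrite expr0n/= add0r subr0 gt_eqF// flat_gt0// exprn_gt0.
  by rewrite gt_eqF// ltr_pwDl ?flat_ge0// exprn_even_gt0.
apply: smoothD => //; apply: smooth_flat.
by apply: smoothB => //; exact: smooth_cst.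
Qed.

(** The function is [1] on an open set [V] and [0] on the complement of a compact set
[F], so that its derivatives too are trivial on [K] and outside [U]. *)
Definition has_cutoff (U K : set 'rV[R]_2) : Prop :=
  exists (psi : 'rV[R]_2 -> R^o) (V F : set 'rV[R]_2),
    [/\ smooth psi, open V /\ K `<=` V, compact F /\ F `<=` U,
        forall z, V z -> psi z = 1 & forall z, ~ F z -> psi z = 0].

Definition sqr_dist x : 'rV[R]_2 -> R^o := fun z => \sum_k (z 0 k - x 0 k) ^+ 2.

Lemma smooth_sqr_dist x : smooth (sqr_dist x).
Proof.
apply: smooth_sum => k.
have sk : smooth (fun z => z 0 k - x 0 k : R^o).
  by apply: smoothB; [exact: smooth_coord|exact: smooth_cst].
exact: (smoothM sk sk).
Qed.

Lemma norm_le_sqr_dist x z (d : R) : 0 <= d ->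
  sqr_dist x z <= d ^+ 2 -> `|z - x| <= d.
Proof.
move=> d0 zd; rewrite [leLHS]/Num.Def.normr/= mx_normrE bigmax_le//= => -[a k] _ /=.
rewrite ord1 !mxE -(ler_sqr _ d0)// real_normK ?num_real//.
apply: le_trans zd; rewrite /sqr_dist (bigD1 k)//= lerDl.
by apply: sumr_ge0 => l _; exact: sqr_ge0.
Qed.

Lemma has_cutoff_point U x : nbhs x U -> has_cutoff U [set x].
Proof.
move=> /nbhs_ballP[d d0 Ud].
have e0 : 0 < d / 2 by rewrite divr_gt0.
have e20 : 0 < (d / 2) ^+ 2 by rewrite exprn_gt0.
have e2n0 : (d / 2) ^+ 2 != 0 by rewrite gt_eqF.
have cq := smooth_continuous (smooth_sqr_dist x).
pose F := [set z | sqr_dist x z <= (d / 2) ^+ 2].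
(* With radius r = d / 2, the argument of [step] is at least 1 where the squared
   distance is at most r ^ 2 / 2, and it is at most 0 where it is at least r ^ 2. *)
exists (fun z => step (2 - 2 * ((d / 2) ^- 2 * sqr_dist x z)) : R^o).
exists [set z | sqr_dist x z < (d / 2) ^+ 2 / 2], F; split.
- apply: smooth_step; apply: smoothB; first exact: smooth_cst.
  apply: smoothM; first exact: smooth_cst.
  by apply: smoothM; [exact: smooth_cst|exact: smooth_sqr_dist].
- split.
    apply: (@open_comp _ R (sqr_dist x) [set y : R | y < (d / 2) ^+ 2 / 2]).
      by move=> z _; exact: cq.
    exact: open_lt.
  move=> z ->; rewrite /sqr_dist /= big1 ?divr_gt0// => k _.
  by rewrite subrr expr0n.
- have FB z : F z -> `|z - x| <= d / 2 by move=> ?; exact: norm_le_sqr_dist (ltW e0) _.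
  split.
    apply: bounded_closed_compact.
      exists (`|x| + d / 2); split; first exact: num_real.
      move=> r hr z Fz /=; have := ler_normD (z - x) x; rewrite subrK => zx.
      by rewrite (le_trans zx)// addrC (le_trans _ (ltW hr))// lerD2l FB.
    apply: (@closed_comp _ R (sqr_dist x) [set y : R | y <= (d / 2) ^+ 2]).
      by move=> z _; exact: cq.
    exact: closed_le.
  move=> z /FB zx; apply: Ud; rewrite -ball_normE/= distrC (le_lt_trans zx)//.
  by rewrite ltr_pdivrMr// ltr_pMr// ltr1n.
- move=> z /= zV; apply: step1.
  have : (d / 2) ^- 2 * sqr_dist x z <= 2^-1.
    by rewrite mulrC ler_pdivrMr// mulrC ltW.
  lra.
- move=> z /= /negP; rewrite -ltNge => zF; apply: step0.
  have : 1 <= (d / 2) ^- 2 * sqr_dist x z.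
    by rewrite mulrC ler_pdivlMr// mul1r ltW.
  lra.
Qed.

(** The complements in [K] of the sets with property [P] would otherwise generate a
proper filter on [K] without cluster point. *)
Lemma compact_local_to_global (T : topologicalType) (P : set T -> Prop) (K : set T) :
  P set0 -> (forall A B, P A -> P B -> P (A `|` B)) ->
  (forall A B, A `<=` B -> P B -> P A) ->
  (forall x : T, K x -> exists2 U, nbhs x U & P U) ->
  compact K -> P K.
Proof.
move=> P0 PU PS PK cK; apply: contrapT => NPK.
pose G := [set A | P (K `\` A)].
have FG : ProperFilter G.
  apply: Build_ProperFilter_ex => [A GA|].
    apply/set0P/eqP => A0; apply: NPK.
    by move: GA; rewrite /G/= A0 setD0.
  split.
  - by rewrite /G/= setDT.
  - by move=> A B GA GB; rewrite /G/= setDIr; exact: PU.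
  - by move=> A B AB; apply: PS; exact: setDS.
have [|x [Kx clx]] := cK G FG; first by rewrite /G/= setDv.
have [U xU PU'] := PK x Kx.
have GU : G (~` U) by apply: PS PU'; rewrite setDE setCK; exact: subIsetr.
by have [y [/= nUy Uy]] := clx _ _ GU xU.
Qed.

Lemma compact_has_cutoff U K : open U -> compact K -> K `<=` U -> has_cutoff U K.
Proof.
move=> oU cK KU; apply: compact_local_to_global cK.
- exists (fun=> 0), set0, set0; split=> //; first exact: smooth_cst.
  + by split => //; exact: open0.
  + by split => //; exact: compact0.
- move=> A B [f [V [F [sf [oV AV] [cF FU] f1 f0]]]].
  move=> [g [W [H [sg [oW BW] [cH HU] g1 g0]]]].
  exists (fun z => f z + (1 - f z) * g z), (V `|` W), (F `|` H); split.
  + apply: smoothD => //; apply: smoothM => //; apply: smoothB => //.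
    exact: smooth_cst.
  + by split; [exact: openU|exact: setUSS].
  + by split; [exact: compactU|rewrite subUset].
  + by move=> z [/f1 ->|/g1 ->]; ring.
  + by move=> z /not_orP[/f0 -> /g0 ->]; ring.
- move=> A B AB [f [V [F [sf [oV BV] cF f1 f0]]]].
  by exists f, V, F; split => //; split => //; exact: subset_trans AB BV.
- move=> x Kx; have [] := @has_cutoff_point U x.
    by apply: open_nbhs_nbhs; split => //; exact: KU.
  move=> f [V [F [sf [oV xV] cF f1 f0]]]; exists V.
    by apply: open_nbhs_nbhs; split => //; exact: xV.
  by exists f, V, F; split => //; split.
Qed.

End Cutoffs.

Local Opaque partial.

(** * Flat metrics and developability *)

Section Isometry.
Context {R : realType}.
Implicit Types (f g : 'rV[R]_2 -> R^o) (x : 'rV[R]_2) (a b c : 'I_2).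

(** The direction is the cross product, which has norm one by Lagrange's identity. *)
Lemma common_normal (a0 a1 a2 b0 b1 b2 : R) :
  a0 * a0 + a1 * a1 + a2 * a2 = 1 -> b0 * b0 + b1 * b1 + b2 * b2 = 1 ->
  a0 * b0 + a1 * b1 + a2 * b2 = 0 ->
  exists n0 n1 n2, n0 * n0 + n1 * n1 + n2 * n2 = 1 /\
    forall h0 h1 h2, h0 * a0 + h1 * a1 + h2 * a2 = 0 ->
      h0 * b0 + h1 * b1 + h2 * b2 = 0 ->
      exists s, [/\ h0 = s * n0, h1 = s * n1 & h2 = s * n2].
Proof.
move=> aa bb ab.
pose n0 := a1 * b2 - a2 * b1; pose n1 := a2 * b0 - a0 * b2; pose n2 := a0 * b1 - a1 * b0.
have nn : n0 * n0 + n1 * n1 + n2 * n2 = 1.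
  transitivity ((a0 * a0 + a1 * a1 + a2 * a2) * (b0 * b0 + b1 * b1 + b2 * b2) -
    (a0 * b0 + a1 * b1 + a2 * b2) ^+ 2); first by rewrite /n0 /n1 /n2; ring.
  by rewrite aa bb ab expr0n/= subr0 mulr1.
exists n0, n1, n2; split => // h0 h1 h2 ha hb.
exists (h0 * n0 + h1 * n1 + h2 * n2).
have expand (h k : R) (p q : R) :
    (n0 * n0 + n1 * n1 + n2 * n2) * h = (h0 * n0 + h1 * n1 + h2 * n2) * k +
      ((h0 * a0 + h1 * a1 + h2 * a2) * (b0 * b0 + b1 * b1 + b2 * b2) -
       (h0 * b0 + h1 * b1 + h2 * b2) * (a0 * b0 + a1 * b1 + a2 * b2)) * p +
      ((h0 * b0 + h1 * b1 + h2 * b2) * (a0 * a0 + a1 * a1 + a2 * a2) -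
       (h0 * a0 + h1 * a1 + h2 * a2) * (a0 * b0 + a1 * b1 + a2 * b2)) * q ->
    h = (h0 * n0 + h1 * n1 + h2 * n2) * k.
  by rewrite nn ha hb !mul0r subrr !mul0r !addr0 mul1r.
by split; [apply: (expand h0 n0 a0 b0)|apply: (expand h1 n1 a1 b1)|
  apply: (expand h2 n2 a2 b2)]; rewrite /n0 /n1 /n2; ring.
Qed.

Lemma partial_cst_on (omega : set 'rV[R]_2) a f (c : R) x :
  open omega -> omega x -> (forall z, omega z -> f z = c) -> partial a f x = 0.
Proof.
move=> oo ox fc; rewrite (@near_eq_partial _ _ f (fun=> c)) ?partial_cst//.
by apply: filterS (open_nbhs_nbhs (conj oo ox)).
Qed.

Lemma eq_on_partial (omega : set 'rV[R]_2) a f g x :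
  open omega -> omega x -> (forall z, omega z -> f z = g z) ->
  partial a f x = partial a g x.
Proof.
move=> oo ox fc; apply: near_eq_partial.
by apply: filterS (open_nbhs_nbhs (conj oo ox)).
Qed.

Section Gauss.
Variables (omega : set 'rV[R]_2) (open_omega : open omega).
Variable Y : 'I_3 -> 'rV[R]_2 -> R^o.
Hypothesis smooth_Y : forall k, smooth (Y k).
Hypothesis metric : forall a b x, omega x ->
  \sum_k partial a (Y k) x * partial b (Y k) x = (a == b)%:R.

Let sp a k : smooth (partial a (Y k)). Proof. exact: smooth_partial. Qed.
Let spp a b k : smooth (partial b (partial a (Y k))). Proof. exact: smooth_partial. Qed.

Let partial_dot c (F G : 'I_3 -> 'rV[R]_2 -> R^o) x :
  (forall k, smooth (F k)) -> (forall k, smooth (G k)) ->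
  partial c (fun z => \sum_k F k z * G k z : R^o) x =
  \sum_k F k x * partial c (G k) x + \sum_k G k x * partial c (F k) x.
Proof.
move=> sF sG; rewrite partial_sum; last by move=> k; exact: smoothM.
rewrite -big_split; apply: eq_bigr => k _.
by rewrite (partialM c (smooth_differentiable x (sF k)) (smooth_differentiable x (sG k))).
Qed.

(** Differentiating the metric shows that the tangential parts of the second
derivatives, the Christoffel symbols of a flat metric, vanish. *)
Lemma second_derivative_normal a b c x : omega x ->
  \sum_k partial b (partial a (Y k)) x * partial c (Y k) x = 0.
Proof.
move=> ox.
pose G a b c := \sum_k partial b (partial a (Y k)) x * partial c (Y k) x.
have G_sym d e q : G d e q = G e d q.
  by apply: eq_bigr => k _; rewrite (partialC _ _ x (smooth_Y k)).
have G_skew d e q : G d q e = - G e q d.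
  apply/eqP; rewrite -addr_eq0; apply/eqP.
  have := @partial_cst_on omega q (fun z => \sum_k partial d (Y k) z * partial e (Y k) z : R^o)
    (d == e)%:R x open_omega ox (metric d e).
  rewrite (@partial_dot q (fun k => partial d (Y k)) (fun k => partial e (Y k)) x
    (sp d) (sp e)).
  move=> E; rewrite -[RHS]E addrC; congr (_ + _).
    by apply: eq_bigr => k _; rewrite mulrC.
  by apply: eq_bigr => k _; rewrite mulrC.
rewrite -/(G a b c).
(* The symmetric and skew exchanges generate the permutations of the three indices. *)
have E : G a b c = - G a b c.
  rewrite {1}(G_skew a c b) (G_sym c b a) (G_skew b a c) opprK (G_sym a c b).
  by rewrite (G_skew c b a) (G_sym b a c).
by lra.
Qed.

(** Gauss's equation for a flat metric: the third derivatives cancel in the difference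
of the derivatives of two vanishing Christoffel symbols. *)
Lemma gauss_equation a b x : omega x ->
  \sum_k partial a (partial a (Y k)) x * partial b (partial b (Y k)) x =
  \sum_k partial b (partial a (Y k)) x * partial b (partial a (Y k)) x.
Proof.
move=> ox.
have E1 := @partial_cst_on omega a
  (fun z => \sum_k partial b (partial b (Y k)) z * partial a (Y k) z : R^o)
  0 x open_omega ox (fun z oz => second_derivative_normal b b a oz).
have E2 := @partial_cst_on omega b
  (fun z => \sum_k partial b (partial a (Y k)) z * partial a (Y k) z : R^o)
  0 x open_omega ox (fun z oz => second_derivative_normal a b a oz).
rewrite (@partial_dot a (fun k => partial b (partial b (Y k)))
  (fun k => partial a (Y k)) x (spp b b) (sp a)) in E1.
rewrite (@partial_dot b (fun k => partial b (partial a (Y k)))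
  (fun k => partial a (Y k)) x (spp a b) (sp a)) in E2.
have E3 : \sum_k partial a (Y k) x * partial a (partial b (partial b (Y k))) x =
          \sum_k partial a (Y k) x * partial b (partial b (partial a (Y k))) x.
  apply: eq_bigr => k _; rewrite (@partialC _ _ b a x (sp b k)).
  have -> // : partial a (partial b (Y k)) = partial b (partial a (Y k)).
  by apply/funext => z; exact: (@partialC _ _ b a z (smooth_Y k)).
have comm : \sum_k partial a (partial a (Y k)) x * partial b (partial b (Y k)) x =
  \sum_k partial b (partial b (Y k)) x * partial a (partial a (Y k)) x.
  by apply: eq_bigr => k _; exact: mulrC.
have cancel (p p' q r r' : R) : p = p' -> p' + r = 0 -> q + r' = 0 -> r = r' -> p = q.
  by move=> -> pr qr rr'; apply: (addIr r); rewrite pr rr'.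
exact: (cancel _ _ _ _ _ comm E1 E2 E3).
Qed.

(** All the second derivatives are multiples of one unit normal; their coefficients
satisfy Gauss's equation, and the third components are these coefficients times the
third component of the normal. *)
Lemma third_component_hessian_det a b x : a != b -> omega x ->
  partial a (partial a (Y ord_max)) x * partial b (partial b (Y ord_max)) x =
  partial b (partial a (Y ord_max)) x ^+ 2.
Proof.
move=> ab ox.
have sum3 (F : 'I_3 -> R) : \sum_k F k = F ord0 + F (lift ord0 ord0) + F ord_max.
  rewrite big_ord_recl big_ord_recl big_ord_recl big_ord0 addr0 addrA.
  by congr (_ + F _); apply/val_inj.
have := metric a a ox; have := metric b b ox; have := metric a b ox.
rewrite !eqxx (negbTE ab) !sum3 => mab mbb maa.
have [n0 [n1 [n2 [nn normal]]]] := common_normal maa mbb mab.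
have par c d : exists s, [/\ partial d (partial c (Y ord0)) x = s * n0,
    partial d (partial c (Y (lift ord0 ord0))) x = s * n1 &
    partial d (partial c (Y ord_max)) x = s * n2].
  apply: normal; rewrite -(sum3 (fun k => partial d (partial c (Y k)) x * partial _ (Y k) x));
    exact: second_derivative_normal.
have [s [sE0 sE1 sE2]] := par a a; have [t [tE0 tE1 tE2]] := par b b.
have [u [uE0 uE1 uE2]] := par a b.
have := etrans (esym (sum3 _)) (etrans (gauss_equation a b ox) (sum3 _)).
rewrite sE0 sE1 sE2 tE0 tE1 tE2 uE0 uE1 uE2 => gauss.
have E : s * t = u * u.
  transitivity (s * t * (n0 * n0 + n1 * n1 + n2 * n2)); first by rewrite nn mulr1.
  transitivity (u * u * (n0 * n0 + n1 * n1 + n2 * n2)); last by rewrite nn mulr1.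
  by apply: etrans (etrans gauss _); ring.
transitivity (s * t * n2 ^+ 2); first by ring.
by rewrite E; ring.
Qed.

End Gauss.

(** The Hessian of [v] is singular on [omega]; its symmetry is left to [partialC]. *)
Definition developable (omega : set 'rV[R]_2) (v : 'rV[R]_2 -> R^o) : Prop :=
  forall a b x, a != b -> omega x ->
    partial a (partial a v) x * partial b (partial b v) x =
    partial b (partial a v) x ^+ 2.

Lemma V0_developable omega v : open omega -> V0 omega v -> developable omega v.
Proof.
move=> oo [sv [eta [eta0 [y [[sy iso _] vy]]]]] a b x ab ox.
pose Y (k : 'I_3) : 'rV[R]_2 -> R^o := fun z => y z 0 k.
have sY k : smooth (Y k) by exact: smooth_entry.
have dy z : differentiable y z by have [] := sy 1%N.
have metric c d z : omega z ->
    \sum_k partial c (Y k) z * partial d (Y k) z = (c == d)%:R.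
  move=> oz; have := iso z oz => /matrixP/(_ c d); rewrite !mxE => <-.
  by apply: eq_bigr => k _; rewrite !mxE /Y !partial_entry.
have vY z : omega z -> v z = eta^-1 * Y ord_max z.
  move=> oz; rewrite /Y -vy ?mulKf ?gt_eqF//.
  exact: subset_closure.
have hess c d : partial d (partial c v) x = eta^-1 * partial d (partial c (Y ord_max)) x.
  have E z : omega z -> partial c v z = eta^-1 * partial c (Y ord_max) z.
    move=> oz; rewrite (eq_on_partial c oo oz vY) partialZ//.
    exact: smooth_differentiable.
  rewrite (eq_on_partial d oo ox E) partialZ//.
  exact/smooth_differentiable/smooth_partial.
have det := third_component_hessian_det oo sY metric ab ox.
rewrite !hess.
transitivity (eta^-1 ^+ 2 *
  (partial a (partial a (Y ord_max)) x * partial b (partial b (Y ord_max)) x)).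
  by move: (partial a _ x) (partial b _ x) => p q; ring.
by rewrite det exprMn.
Qed.

Lemma continuous_eq0_closure (omega U : set 'rV[R]_2) f : continuous f -> open U ->
  (forall x, omega x -> U x -> f x = 0) ->
  forall x, closure omega x -> U x -> f x = 0.
Proof.
move=> cf oU f0 x cx Ux; apply/eqP/negPn/negP => fx0.
have oV : open [set z | f z != 0].
  apply: (@open_comp _ R f [set t : R | t != 0]); first by move=> z _; exact: cf.
  exact: open_neq.
have [z [oz [Uz /eqP fz]]] := cx _ (filterI (open_nbhs_nbhs (conj oU Ux))
  (open_nbhs_nbhs (conj oV fx0))).
by apply: fz; exact: f0.
Qed.

End Isometry.

(** * Two facts on the real line, and convexity of the closure *)

Section RealLine.
Context {R : realType}.
Implicit Types (f q : R -> R) (T t c : R).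

(** Uniqueness for a linear homogeneous differential equation: the square of a
solution, damped by an exponential, decreases. *)
Lemma linear_ode_zero f q T : 0 <= T -> continuous f -> continuous q ->
  (forall t, 0 < t < T -> is_derive t 1 f (q t * f t)) -> f 0 = 0 ->
  forall t, 0 <= t <= T -> f t = 0.
Proof.
move=> T0 cf cq df f0 t t0T.
have cq' : continuous (fun s => `|q s|).
  by move=> s; apply: continuous_comp; [exact: cq|exact: norm_continuous].
have [s _ qs] := @EVT_max R _ 0 T T0 (@continuous_subspaceT _ _ _ _ cq').
pose C : R := `|q s|.
pose g (u : R) : R := f u * f u * expR (- (2 * C * u)).
have dE (u : R) : is_derive u 1 (fun u : R => expR (- (2 * C * u)))
    (expR (- (2 * C * u)) * - (2 * C)).
  have dl : is_derive u 1 (fun u : R => - (2 * C * u)) (- (2 * C)).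
    have := is_deriveN (is_deriveZ (2 * C) (is_derive_id u (1 : R))).
    by rewrite /GRing.scale/= mulr1; exact.
  exact: (@is_derive1_comp R expR (fun u : R => - (2 * C * u)) u _ _
    (is_derive_expR _) dl).
have dg (u : R) : 0 < u < T -> is_derive u 1 g
    (2 * (q u - C) * (f u * f u * expR (- (2 * C * u)))).
  move=> /df dfu; have := is_deriveM (is_deriveM dfu dfu) (dE u).
  suff -> : (f * f) u *: (expR (- (2 * C * u)) * - (2 * C)) +
    expR (- (2 * C * u)) *: (f u *: (q u * f u) + f u *: (q u * f u)) =
    2 * (q u - C) * (f u * f u * expR (- (2 * C * u))) by [].
  rewrite /GRing.scale/= !fctE; ring.
have cg : continuous g.
  have cE : continuous (fun u : R => expR (- (2 * C * u))).
    by move=> u; apply: differentiable_continuous; apply/derivable1_diffP; have := dE u.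
  by move=> u; apply: cvgM; [apply: cvgM; exact: cf|exact: cE].
have in0T (u : R) : 0 <= u <= T -> u \in `[0, T] by rewrite in_itv.
have g_le : g t <= g 0.
  have [t0 tT] := andP t0T.
  apply: (@ler0_derive1_le_cc R g 0 T) => //.
  - by move=> u /[!in_itv]/= /dg [].
  - move=> u /[!in_itv]/= u0T; rewrite derive1E (@derive_val _ _ _ _ _ _ _ (dg u u0T)).
    have fe0 : 0 <= f u * f u * expR (- (2 * C * u)).
      by rewrite mulr_ge0 ?expR_ge0// -expr2 sqr_ge0.
    have qC : q u <= C.
      rewrite (le_trans (ler_norm _))//; apply: qs; rewrite in_itv/=.
      by case/andP: u0T => u0 uT; rewrite !ltW.
    by rewrite mulr_le0_ge0// mulr_ge0_le0// subr_le0.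
  - exact: continuous_subspaceT.
  - by apply: in0T; rewrite lexx.
move: g_le; rewrite /g f0 !mul0r => g_le.
have : f t * f t <= 0 by rewrite -(pmulr_lle0 _ (expR_gt0 (- (2 * C * t)))).
by rewrite -expr2 real_exprn_even_le0 ?num_real//= => /eqP.
Qed.

(** The infimum of the times of failure would be a first time of failure, and by
continuity [f] would still exceed [c] slightly beyond it. *)
Lemma no_first_exit f c T : continuous f ->
  (forall s, 0 <= s <= T -> (forall t, 0 <= t < s -> c < f t) -> c < f s) ->
  forall t, 0 <= t <= T -> c < f t.
Proof.
move=> cf step t t0T; apply: contrapT => /negP; rewrite -leNgt => ftc.
pose E := [set s | 0 <= s <= T /\ f s <= c].
have Et : E t by [].
have lbE : lbound E 0 by move=> s [/andP[]].
have infE : has_inf E by split; [exists t|exists 0].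
have inf0T : 0 <= inf E <= T.
  rewrite lb_le_inf//; last by exists t.
  have [_ tT] := andP t0T.
  by rewrite (le_trans _ tT)//; apply: ge_inf => //; exists 0.
have above s : 0 <= s < inf E -> c < f s.
  move=> /andP[s0 sE]; rewrite ltNge; apply/negP => fsc.
  have : inf E <= s.
    apply: ge_inf; first by exists 0.
    split=> //; rewrite s0 (le_trans (ltW sE))//.
    by case/andP: inf0T.
  by rewrite leNgt sE.
have cfE := step _ inf0T above.
have /nbhs_ballP[d d0 Hd] : \forall s \near inf E, c < f s.
  have /cvgrPdist_lt/(_ _ (_ : 0 < f (inf E) - c)) := cf (inf E).
  rewrite subr_gt0 => /(_ cfE); apply: filterS => s.
  by move=> /(le_lt_trans (ler_norm _)); lra.
have [s Es sd] := inf_adherent d0 infE.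
have : c < f s.
  apply: Hd; rewrite -ball_normE/= distrC ger0_norm ?subr_ge0; first by lra.
  by apply: ge_inf => //; exists 0.
by rewrite ltNge; case: Es => _ ->.
Qed.

End RealLine.

Section Convexity.
Context {R : realType}.
Implicit Types (omega : set 'rV[R]_2) (x y : 'rV[R]_2).

Lemma convex_closure_segment omega :
  convex_set (omega : set (convex_lmodType 'rV[R]_2)) ->
  forall x y (t : R), closure omega x -> closure omega y -> 0 <= t <= 1 ->
    closure omega (x + t *: (y - x)).
Proof.
move=> cvx x y t cx cy /andP[t0 t1] U /nbhs_ballP[e e0 eU].
have [x' [ox' /= xx']] := cx _ (nbhsx_ballx x e e0).
have [y' [oy' /= yy']] := cy _ (nbhsx_ballx y e e0).
exists (x' + t *: (y' - x')); split.
  have oxy : omega (t *: y' + (1 - t) *: x').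
    exact: (set_mem (cvx y' x' (Itv01 t0 t1) (mem_set oy') (mem_set ox'))).
  suff <- : t *: y' + (1 - t) *: x' = x' + t *: (y' - x') by [].
  by apply/rowP => k; rewrite !mxE; ring.
apply: eU; move: xx' yy'; rewrite -ball_normE/= => xx' yy'.
have -> : x + t *: (y - x) - (x' + t *: (y' - x')) =
    (1 - t) *: (x - x') + t *: (y - y').
  by apply/rowP => k; rewrite !mxE; ring.
rewrite (le_lt_trans (ler_normD _ _))// !normrZ.
rewrite (ger0_norm t0) ger0_norm ?subr_ge0//.
pose M := Num.max `|x - x'| `|y - y'|.
apply: (@le_lt_trans _ _ ((1 - t) * M + t * M)).
  by rewrite lerD// ler_wpM2l ?subr_ge0// le_max lexx ?orbT.
by rewrite -mulrDl subrK mul1r gt_max xx' yy'.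
Qed.

End Convexity.

(** * The slope of the rulings *)

Section Slope.
Context {R : realType} (i j : 'I_2) (ij : i != j).
Variables (omega : set 'rV[R]_2) (v : 'rV[R]_2 -> R^o).
Hypotheses (open_omega : open omega) (smooth_v : smooth v).
Hypothesis dev_v : developable omega v.
Implicit Types (x z : 'rV[R]_2) (c : R).

Definition vjj : 'rV[R]_2 -> R^o := partial j (partial j v).

Definition vij : 'rV[R]_2 -> R^o := partial j (partial i v).

(** The slope of the ruling: the kernel of the Hessian of [v] is spanned by the
vector of coordinates [(1, slope)] wherever [vjj] is at least [c] in absolute
value. *)
Definition slope c : 'rV[R]_2 -> R^o := fun x => - (vij x * soft_inv c (vjj x)).

Definition steep c : set 'rV[R]_2 := [set x | c < `|vjj x|].

Lemma smooth_vjj : smooth vjj.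
Proof. exact: smooth_partial (smooth_partial j smooth_v). Qed.

Lemma smooth_vij : smooth vij.
Proof. exact: smooth_partial (smooth_partial i smooth_v). Qed.

Lemma smooth_slope c : 0 < c -> smooth (slope c).
Proof.
move=> c0; apply: smoothN; apply: smoothM; first exact: smooth_vij.
by apply: smooth_soft_inv => //; exact: smooth_vjj.
Qed.

Lemma open_steep c : open (steep c).
Proof.
apply: (@open_comp _ R (fun x => `|vjj x|) [set t : R | c < t]); last exact: open_gt.
move=> x _; apply: continuous_comp; last exact: norm_continuous.
by have := smooth_continuous smooth_vjj; exact.
Qed.

Lemma slopeE c x : 0 < c -> steep c x -> slope c x = - (vij x / vjj x).
Proof. by move=> c0 sx; rewrite /slope soft_invE// ltW. Qed.

Lemma steep_neq0 c x : 0 < c -> steep c x -> vjj x != 0.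
Proof. by move=> c0 sx; rewrite -normr_gt0 (lt_trans c0 sx). Qed.

Lemma slope_vjj c x : 0 < c -> steep c x -> vij x = - (slope c x * vjj x).
Proof. by move=> c0 sx; rewrite slopeE// mulNr opprK divfK// (steep_neq0 c0 sx). Qed.

Lemma hessian_slope c x : 0 < c -> omega x -> steep c x ->
  partial i (partial i v) x = slope c x * slope c x * vjj x.
Proof.
move=> c0 ox sx; have l0 := steep_neq0 c0 sx.
apply: (mulIf l0); rewrite [LHS](dev_v ij ox).
have -> : partial j (partial i v) x = - (slope c x * vjj x) by exact: slope_vjj.
ring.
Qed.

Let dl x : differentiable vjj x. Proof. exact: smooth_differentiable smooth_vjj. Qed.
Let ds c x (c0 : 0 < c) : differentiable (slope c) x.
Proof. exact: smooth_differentiable (smooth_slope c0). Qed.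

Lemma partial_vij k c x : 0 < c -> steep c x -> partial k vij x =
  - (slope c x * partial k vjj x + vjj x * partial k (slope c) x).
Proof.
move=> c0 sx.
have sl : differentiable (fun z => slope c z * vjj z : R^o) x.
  exact: smooth_differentiable (smoothM (smooth_slope c0) smooth_vjj).
have := @eq_on_partial R (steep c) k vij (fun z => - (slope c z * vjj z) : R^o) x
  (@open_steep c) sx (fun z sz => slope_vjj c0 sz).
move=> E; exact: (etrans E (etrans (partialN k sl)
  (congr1 -%R (partialM k (@ds c x c0) (dl x))))).
Qed.

(** The symmetry of the third derivatives: the derivative of [vjj] in the variable i is
that of [vij = - slope * vjj] in the variable j. *)
Lemma vjj_transport c x : 0 < c -> steep c x ->
  partial i vjj x + slope c x * partial j vjj x = - (partial j (slope c) x * vjj x).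
Proof.
move=> c0 sx.
have E : partial i vjj x = partial j vij x.
  rewrite /vjj (partialC j i x (smooth_partial j smooth_v)) /vij.
  have -> // : partial i (partial j v) = partial j (partial i v).
  by apply/funext => z; exact: partialC.
have alg (a b s l lj sj : R) : a = b -> b = - (s * lj + l * sj) ->
    a + s * lj = - (sj * l) by move=> -> ->; ring.
exact: (alg _ _ _ _ _ _ E (partial_vij j c0 sx)).
Qed.

(** The same symmetry for the entries (i, i) and (i, j), which are [slope ^ 2 * vjj] and
[- slope * vjj]. *)
Lemma slope_burgers_in c x : 0 < c -> omega x -> steep c x ->
  partial i (slope c) x + slope c x * partial j (slope c) x = 0.
Proof.
move=> c0 ox sx; have l0 := steep_neq0 c0 sx.
have E : partial j (partial i (partial i v)) x = partial i vij x.
  exact: (@partialC _ _ i j x (smooth_partial i smooth_v)).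
have ss : differentiable (fun z => slope c z * slope c z : R^o) x.
  exact: smooth_differentiable (smoothM (smooth_slope c0) (smooth_slope c0)).
have E1 : partial j (partial i (partial i v)) x =
    slope c x * slope c x * partial j vjj x +
    vjj x * (slope c x * partial j (slope c) x + slope c x * partial j (slope c) x).
  have oU : open (omega `&` steep c) by exact: openI open_omega (@open_steep c).
  have := @eq_on_partial R (omega `&` steep c) j (partial i (partial i v))
    (fun z => slope c z * slope c z * vjj z : R^o) x oU (conj ox sx)
    (fun z osz => hessian_slope c0 osz.1 osz.2).
  move=> E0; apply: (etrans E0 (etrans (partialM j ss (dl x)) _)).
  by congr (_ + _ * _); exact: (partialM j (@ds c x c0) (@ds c x c0)).
have E2 := partial_vij i c0 sx.
have E3 := vjj_transport c0 sx.
have alg (d d' s l li lj si sj : R) : l != 0 -> d = d' ->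
    d = s * s * lj + l * (s * sj + s * sj) -> d' = - (s * li + l * si) ->
    li + s * lj = - (sj * l) -> si + s * sj = 0.
  move=> l_neq0 dd' Ed Ed' Eli; apply: (mulIf l_neq0); rewrite mul0r.
  have {}Eli : li = - (sj * l) - s * lj by rewrite -Eli addrK.
  have : d - d' = 0 by rewrite dd' subrr.
  by rewrite Ed Ed' Eli => <-; ring.
exact: (alg _ _ _ _ _ _ _ _ l0 E E1 E2 E3).
Qed.

Lemma slope_burgers c x : 0 < c -> closure omega x -> steep c x ->
  partial i (slope c) x + slope c x * partial j (slope c) x = 0.
Proof.
move=> c0; have ss := smooth_slope c0.
apply: (@continuous_eq0_closure R omega (steep c)
  (fun x => partial i (slope c) x + slope c x * partial j (slope c) x)).
- apply: smooth_continuous; apply: smoothD; first exact: smooth_partial.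
  by apply: smoothM => //; exact: smooth_partial.
- exact: open_steep.
- by move=> z; exact: slope_burgers_in.
Qed.

Lemma hessian_slope_closure c x : 0 < c -> closure omega x -> steep c x ->
  partial i (partial i v) x = slope c x * slope c x * vjj x.
Proof.
move=> c0 cx sx; have ss := smooth_slope c0; apply/eqP; rewrite -subr_eq0; apply/eqP.
move: x cx sx.
apply: (@continuous_eq0_closure R omega (steep c)
  (fun x => partial i (partial i v) x - slope c x * slope c x * vjj x)).
- apply: smooth_continuous; apply: smoothB; first exact: smooth_partial (smooth_partial i smooth_v).
  by apply: smoothM; [exact: smoothM|exact: smooth_vjj].
- exact: open_steep.
- by move=> z oz sz; rewrite (hessian_slope c0 oz sz) subrr.
Qed.

(** Differentiating Burgers' equation across the lines. *)
Lemma slope_rate c x : 0 < c -> closure omega x -> steep c x ->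
  partial i (partial j (slope c)) x + slope c x * partial j (partial j (slope c)) x =
  - (partial j (slope c) x * partial j (slope c) x).
Proof.
move=> c0 cx sx; have ss := smooth_slope c0; apply/eqP; rewrite -addr_eq0; apply/eqP.
have sjs := smooth_partial j ss; have sis := smooth_partial i ss.
move: x cx sx.
apply: (@continuous_eq0_closure R omega (steep c)
  (fun x => partial i (partial j (slope c)) x + slope c x * partial j (partial j (slope c)) x +
    partial j (slope c) x * partial j (slope c) x)).
- apply: smooth_continuous; apply: smoothD; last exact: smoothM.
  apply: smoothD; first exact: smooth_partial.
  by apply: smoothM => //; exact: smooth_partial.
- exact: open_steep.
- move=> z oz sz.
  have oU : open (omega `&` steep c) by exact: openI open_omega (@open_steep c).
  have dsz := smooth_differentiable z ss.
  have djz := smooth_differentiable z sjs.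
  have diz := smooth_differentiable z sis.
  have dm := smooth_differentiable z (smoothM ss sjs).
  have E0 := @partial_cst_on R (omega `&` steep c) j
    (fun x => partial i (slope c) x + slope c x * partial j (slope c) x) 0 z oU
    (conj oz sz) (fun y osy => slope_burgers_in c0 osy.1 osy.2).
  have E1 := etrans (esym (partialD j diz dm)) E0.
  have alg (a a' b d s : R) : a + d = 0 -> d = s * b + a' -> a + s * b + a' = 0.
    by move=> ad E; rewrite -addrA -E ad.
  have E2 : partial j (partial i (slope c)) z = partial i (partial j (slope c)) z.
    exact: partialC.
  rewrite -E2.
  exact: (alg _ _ _ _ _ E1 (partialM j dsz djz)).
Qed.

End Slope.

(** * Rulings reach the boundary *)

(** Evolution along a line of direction [(1, M 0)]: the slope [M] is constant, the
second derivative [L] is the inverse of an affine function. The letters i and j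
mark the partial derivatives, [P] being the one of [M] in the second variable;
the vanishing quantities [M - M 0], [P * L 0 - P 0 * L] and
[L * (1 + t * (s * P 0)) - L 0] all solve [f' = - (s * P) * f]. *)
Lemma ruling_ode (R : realType) (L M P Li Lj Mi Pi Pj : R -> R) (s T : R) :
  0 <= T -> continuous L -> continuous M -> continuous P ->
  (forall t : R, is_derive t 1 L (s * (Li t + M 0 * Lj t))) ->
  (forall t : R, is_derive t 1 M (s * (Mi t + M 0 * P t))) ->
  (forall t : R, is_derive t 1 P (s * (Pi t + M 0 * Pj t))) ->
  (forall t, 0 < t < T -> Mi t + M t * P t = 0) ->
  (forall t, 0 < t < T -> Li t + M t * Lj t = - (P t * L t)) ->
  (forall t, 0 < t < T -> Pi t + M t * Pj t = - (P t * P t)) ->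
  forall t, 0 <= t <= T -> M t = M 0 /\ L t * (1 + t * (s * P 0)) = L 0.
Proof.
move=> T0 cL cM cP dL dM dP eM eL eP.
pose q (t : R) : R := - (s * P t).
have cq : continuous q by move=> t; apply: cvgN; apply: cvgMl_tmp; exact: cP.
have subT t : 0 < t < T -> 0 <= t <= T by move=> /andP[t0 tT]; rewrite !ltW.
have MM t : 0 <= t <= T -> M t = M 0.
  move=> t0T; apply/eqP; rewrite -subr_eq0; apply/eqP; move: t t0T.
  apply: (@linear_ode_zero R (fun t => M t - M 0) q T T0 _ cq) => //.
  - by move=> t; apply: cvgB; [exact: cM|exact: cvg_cst].
  - move=> t t0T; apply: (is_derive_eq (is_deriveB (dM t) (is_derive_cst (M 0) t 1))).
    have -> : Mi t = - (M t * P t) by apply/eqP; rewrite -addr_eq0 eM.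
    by rewrite /q; ring.
  - by rewrite subrr.
have PL t : 0 <= t <= T -> L 0 * P t - P 0 * L t = 0.
  move: t; apply: (@linear_ode_zero R (fun t => L 0 * P t - P 0 * L t) q T T0 _ cq) => //.
  - by move=> t; apply: cvgB; apply: cvgMl_tmp; [exact: cP|exact: cL].
  - move=> t t0T.
    apply: (is_derive_eq (is_deriveB (is_deriveZ (L 0) (dP t)) (is_deriveZ (P 0) (dL t)))).
    have := eP t t0T; have := eL t t0T; rewrite (MM t (subT t t0T)) => -> ->.
    by rewrite /q /GRing.scale/=; ring.
  - by rewrite mulrC subrr.
have LL t : 0 <= t <= T -> L t * (1 + t * (s * P 0)) - L 0 = 0.
  move: t; apply: (@linear_ode_zero R
    (fun t => L t * (1 + t * (s * P 0)) - L 0) q T T0 _ cq) => //.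
  - move=> t; apply: cvgB; last exact: cvg_cst.
    apply: cvgM; first exact: cL.
    by apply: cvgD; [exact: cvg_cst|apply: cvgMr_tmp; exact: cvg_id].
  - move=> t t0T.
    have dA : is_derive t 1 (fun t : R => 1 + t * (s * P 0)) (s * P 0).
      have := is_deriveD (is_derive_cst (1 : R) t 1)
        (is_deriveM (is_derive_id t (1 : R)) (is_derive_cst (s * P 0) t 1)).
      by rewrite add0r scaler0 add0r /GRing.scale/= mulr1; exact.
    apply: (is_derive_eq (is_deriveB (is_deriveM (dL t) dA) (is_derive_cst (L 0) t 1))).
    have := PL t (subT t t0T) => /eqP; rewrite subr_eq0 => /eqP PLt.
    have := eL t t0T; rewrite (MM t (subT t t0T)) => ->.
    rewrite /q /GRing.scale/= subr0.
    have -> : L t * (s * P 0) = s * (P 0 * L t) by ring.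
    by rewrite -PLt; ring.
  - by rewrite mul0r addr0 mulr1 subrr.
move=> t t0T; split; first exact: MM.
by apply/eqP; rewrite -subr_eq0 LL.
Qed.

(** A lower bound for the inverse of the affine factor in [ruling_ode], uniform on the
unit interval. *)
Lemma affine_factor_bound (R : realType) (T a c l l0 : R) : 0 <= T <= 1 ->
  c < `|l0| -> l * (1 + T * a) = l0 -> c / (1 + `|a|) < `|l|.
Proof.
move=> /andP[T0 T1] cl l0E.
have a_pos : 0 < 1 + `|a| by rewrite ltr_pwDl.
have aff : `|1 + T * a| <= 1 + `|a|.
  rewrite (le_trans (ler_normD _ _))// normr1 lerD2l normrM ger0_norm//.
  by rewrite ler_piMl.
rewrite ltr_pdivrMr//; move: cl; rewrite -l0E normrM => cl.
by apply: (lt_le_trans cl); rewrite ler_wpM2l.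
Qed.

Section Ruling.
Context {R : realType} (i j : 'I_2) (ij : i != j).
Variables (omega : set 'rV[R]_2) (v : 'rV[R]_2 -> R^o).
Hypotheses (open_omega : open omega) (smooth_v : smooth v).
Hypothesis dev_v : developable omega v.
Hypothesis convex_omega : convex_set (omega : set (convex_lmodType 'rV[R]_2)).
Implicit Types (x z : 'rV[R]_2) (c : R).

Definition direction (m0 : R) : 'rV[R]_2 := delta_mx 0 i + m0 *: delta_mx 0 j.

Lemma is_derive_along (h : 'rV[R]_2 -> R^o) x (s m0 t : R) : smooth h ->
  is_derive t 1 ((fun t => h (x + t *: (s *: direction m0))) : R -> R)
    (s * (partial i h (x + t *: (s *: direction m0)) +
          m0 * partial j h (x + t *: (s *: direction m0)))).
Proof.
move=> sh; set w := s *: direction m0.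
have D := is_derive_line (@smooth_derivable R h (x + t *: w) w sh).
have E : 'D_w h (x + t *: w) =
    s * (partial i h (x + t *: w) + m0 * partial j h (x + t *: w)).
  apply: (etrans (derive_partials w (smooth_differentiable (x + t *: w) sh))).
  apply: (etrans (@big_ord2 R _ i j ij)).
  rewrite /w /direction !mxE !eqxx (negbTE ij) [j == i]eq_sym (negbTE ij) /=.
  have alg (a b : R) : s * (1 + m0 * 0) * a + s * (0 + m0 * 1) * b = s * (a + m0 * b).
    ring.
  exact: alg.
by rewrite -E; exact: D.
Qed.

Lemma continuous_along (h : 'rV[R]_2 -> R^o) x w : continuous h ->
  continuous ((fun t => h (x + t *: w)) : R -> R).
Proof.
move=> ch t; apply: (@continuous_comp _ _ _ (fun t : R => x + t *: w) h); last exact: ch.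
by apply: cvgD; [exact: cvg_cst|apply: cvgZr_tmp; exact: cvg_id].
Qed.

(** By [ruling_ode], as long as [vjj] does not vanish the slope is constant and [vjj] is
the inverse of an affine function, hence bounded below on the segment from [x] to [z];
so it cannot reach [0]. The equations being valid on the closure, the segment may lie
in the boundary. *)
Lemma ruling_line x z : closure omega x -> closure omega z -> vjj j v x != 0 ->
  z 0 j - x 0 j = - (vij i j v x / vjj j v x) * (z 0 i - x 0 i) ->
  vjj j v z != 0 /\ vij i j v z / vjj j v z = vij i j v x / vjj j v x.
Proof.
move=> cx cz lx0; set m0 := - (_ / _) => zx.
pose s : R := z 0 i - x 0 i.
have x_pos : 0 < `|vjj j v x| by rewrite normr_gt0.
(* The bound [c] is chosen below the values that [ruling_ode] will force on [vjj] along
   the segment, so that the region where the slope is defined cannot be left. *)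
pose c1 : R := `|vjj j v x| / 2.
have c1_pos : 0 < c1 by rewrite divr_gt0.
pose p0 : R := partial j (slope i j v c1) x.
pose c : R := c1 / (1 + `|s * p0|).
have sp_pos : 0 < 1 + `|s * p0| by rewrite ltr_pwDl.
have c_pos : 0 < c by rewrite divr_gt0.
have cc1 : c <= c1 by rewrite ler_pdivrMr// ler_peMr ?lerDl// ltW.
have xc1 : steep j v c1 x by rewrite /steep/= ltr_pdivrMr// ltr_pMr// ltr1n.
have xc : steep j v c x by exact: le_lt_trans cc1 xc1.
pose m := slope i j v c.
have sm : smooth m by exact: smooth_slope.
have sl := smooth_vjj j smooth_v.
have mx : m x = m0 by exact: (slopeE i c_pos xc).
have px : partial j m x = p0.
  have m_eq y : steep j v c1 y -> m y = slope i j v c1 y.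
    move=> yc1; have yc : steep j v c y by exact: le_lt_trans cc1 yc1.
    exact: (etrans (slopeE i c_pos yc) (esym (slopeE i c1_pos yc1))).
  exact: (@eq_on_partial R (steep j v c1) j m (slope i j v c1) x
    (@open_steep R j v smooth_v c1) xc1 m_eq).
pose w := s *: direction m0.
have wE : w = z - x.
  apply/rowP => k; rewrite !mxE; case: (ord2_case k ij) => ->; rewrite !eqxx/=.
    by rewrite (negbTE ij) mulr0 addr0 mulr1.
  by rewrite [j == i]eq_sym (negbTE ij) add0r mulr1 [RHS]zx mulrC.
have on_line t : 0 <= t <= 1 -> closure omega (x + t *: w).
  by rewrite wE; exact: convex_closure_segment.
have z1 : x + 1 *: w = z by rewrite scale1r wE addrC subrK.
have x0 : x + 0 *: w = x by rewrite scale0r addr0.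
pose L (t : R) : R := vjj j v (x + t *: w).
pose M (t : R) : R := m (x + t *: w).
pose P (t : R) : R := partial j m (x + t *: w).
have sp := smooth_partial j sm.
have M0 : M 0 = m0 by rewrite /M x0.
have P0 : P 0 = p0 by rewrite /P x0.
have L0 : L 0 = vjj j v x by rewrite /L x0.
have cL : continuous L by exact: continuous_along (smooth_continuous sl).
have cM : continuous M by exact: continuous_along (smooth_continuous sm).
have cP : continuous P by exact: continuous_along (smooth_continuous sp).
have along T : 0 <= T <= 1 -> (forall t, 0 <= t < T -> c < `|L t|) ->
    forall t, 0 <= t <= T -> M t = M 0 /\ L t * (1 + t * (s * P 0)) = L 0.
  move=> /andP[T0 T1] LT.
  have in_closure t : 0 < t < T -> closure omega (x + t *: w).
    move=> /andP[t0 tT]; apply: on_line; apply/andP.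
    by split; [exact: (ltW t0)|exact: (ltW (lt_le_trans tT T1))].
  have in_steep t : 0 < t < T -> steep j v c (x + t *: w).
    move=> /andP[t0 tT]; apply: LT; apply/andP.
    by split; [exact: (ltW t0)|exact: tT].
  apply: (@ruling_ode R L M P (fun t => partial i (vjj j v) (x + t *: w))
    (fun t => partial j (vjj j v) (x + t *: w)) (fun t => partial i m (x + t *: w))
    (fun t => partial i (partial j m) (x + t *: w))
    (fun t => partial j (partial j m) (x + t *: w)) s T T0 cL cM cP).
  - by move=> t; rewrite M0; exact: is_derive_along sl.
  - by move=> t; rewrite M0; exact: is_derive_along sm.
  - by move=> t; rewrite M0; exact: is_derive_along sp.
  - move=> t tT; exact: (slope_burgers ij open_omega smooth_v dev_v c_pos
      (in_closure t tT) (in_steep t tT)).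
  - move=> t tT; exact: (@vjj_transport R i j v smooth_v c (x + t *: w) c_pos (in_steep t tT)).
  - move=> t tT; exact: (slope_rate ij open_omega smooth_v dev_v c_pos
      (in_closure t tT) (in_steep t tT)).
have cnL : continuous (fun t : R => `|L t|).
  by move=> t; apply: continuous_comp; [exact: cL|exact: norm_continuous].
have above : forall t, 0 <= t <= 1 -> c < `|L t|.
  apply: (no_first_exit cnL) => T T01 LT.
  have [T0 T1] := andP T01.
  have [|_ LE] := along T T01 LT T; first by rewrite T0 lexx.
  have c1L : c1 < `|L 0| by rewrite L0; exact: xc1.
  rewrite P0 in LE.
  exact: (affine_factor_bound T01 c1L LE).
have one01 : 0 <= (1 : R) <= 1 by rewrite ler01 lexx.
have zc : steep j v c z by rewrite /steep/= -z1; exact: above.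
split; first exact: steep_neq0 zc.
have above1 t : 0 <= t < 1 -> c < `|L t|.
  by move=> /andP[t0 t1]; apply: above; apply/andP; split; [exact: t0|exact: (ltW t1)].
have [M1 _] := along 1 one01 above1 1 one01.
have mz : m z = m0 by exact: (etrans (congr1 m (esym z1)) (etrans M1 M0)).
exact: (oppr_inj (etrans (esym (slopeE i c_pos zc)) mz)).
Qed.

End Ruling.

(** * Strains that can be solved for *)

Section Separation.
Context {R : realType}.
Implicit Types (x y : 'rV[R]_2) (m : 'rV[R]_2 -> R^o).

(** The signed vertical distance from the line of slope [m x] through [x] to [y]. *)
Definition gap (i j : 'I_2) m x y : R := y 0 j - x 0 j - m x * (y 0 i - x 0 i).

Lemma gap_line_point i j m x t : i != j -> gap i j m x (line_point i j m t x) = 0.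
Proof. by move=> ij; rewrite /gap line_point_i// line_point_j//; ring. Qed.

Lemma near_gap_neq0 i j m x y : continuous m -> gap i j m x y != 0 ->
  \forall x' \near x & y' \near y, gap i j m x' y' != 0.
Proof.
move=> cm gxy.
have cgap : continuous (fun p : 'rV[R]_2 * 'rV[R]_2 => gap i j m p.1 p.2).
  have c1 k : continuous (fun p : 'rV[R]_2 * 'rV[R]_2 => p.1 0 k : R).
    move=> p; apply: (@continuous_comp _ _ _ fst (fun x : 'rV[R]_2 => x 0 k : R)).
      exact: cvg_fst.
    exact: coord_continuous.
  have c2 k : continuous (fun p : 'rV[R]_2 * 'rV[R]_2 => p.2 0 k : R).
    move=> p; apply: (@continuous_comp _ _ _ snd (fun x : 'rV[R]_2 => x 0 k : R)).
      exact: cvg_snd.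
    exact: coord_continuous.
  have cm1 : continuous (fun p : 'rV[R]_2 * 'rV[R]_2 => m p.1 : R).
    by move=> p; apply: continuous_comp; [exact: cvg_fst|exact: cm].
  move=> p; apply: cvgB; first by apply: cvgB; [exact: c2|exact: c1].
  by apply: cvgM; [exact: cm1|apply: cvgB; [exact: c2|exact: c1]].
have oU : open [set p : 'rV[R]_2 * 'rV[R]_2 | gap i j m p.1 p.2 != 0].
  apply: (@open_comp _ R _ [set t : R | t != 0]); first by move=> p _; exact: cgap.
  exact: open_neq.
exact: (open_nbhs_nbhs (conj oU gxy : open_nbhs (x, y) _)).
Qed.

Lemma near_compact_gap (i j : 'I_2) m (B : set 'rV[R]_2) x : continuous m -> compact B ->
  (forall y, B y -> gap i j m x y != 0) ->
  \forall x' \near x, forall y, B y -> gap i j m x' y != 0.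
Proof.
move=> cm cB Bx.
have near_B y : B y -> \forall y' \near y & x' \near x, gap i j m x' y' != 0.
  move=> By; have [[U V] [/= Ux Vy] UV] := near_gap_neq0 cm (Bx y By).
  by exists (V, U) => //= -[y' x'] [/= Vy' Ux']; exact: (UV (x', y')).
exact: ((compact_near_coveringP _).1 cB _ (nbhs x)
  (fun x' y => gap i j m x' y != 0) (nbhs_filter x) near_B).
Qed.

Lemma compact_near_gap (i j : 'I_2) m (E : set 'rV[R]_2) y : continuous m -> compact E ->
  (forall x, E x -> gap i j m x y != 0) ->
  \forall y' \near y, forall x, E x -> gap i j m x y' != 0.
Proof.
move=> cm cE Ey.
exact: ((compact_near_coveringP _).1 cE _ (nbhs y)
  (fun y' x => gap i j m x y' != 0) (nbhs_filter y)
  (fun x Ex => near_gap_neq0 cm (Ey x Ex))).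
Qed.

Lemma compact_closure_bounded (omega : set 'rV[R]_2) : bounded_set omega ->
  compact (closure omega).
Proof.
move=> [M [_ bM]]; apply: bounded_closed_compact; last exact: closed_closure.
exists (M + 1); split; first exact: num_real.
move=> r Mr z cz /=.
have cl : closed [set y : 'rV[R]_2 | `|y| <= r].
  apply: (@closed_comp _ R (fun y : 'rV[R]_2 => `|y|) [set t : R | t <= r]).
    by move=> y _; exact: norm_continuous.
  exact: closed_le.
suff : closure omega `<=` [set y : 'rV[R]_2 | `|y| <= r] by apply.
rewrite [X in _ `<=` X](closure_id _).1//; apply: closure_subset => y oy /=.
by apply: bM => //; rewrite (lt_trans _ Mr)// ltrDl.
Qed.

End Separation.

Section Solvability.
Context {R : realType} (omega : set 'rV[R]_2) (v : 'rV[R]_2 -> R^o).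
Implicit Types (a b : 'I_2 -> 'I_2 -> 'rV[R]_2 -> R^o) (x : 'rV[R]_2).

(** Strains and displacements are families of scalar functions here, so that the
coordinates i and j can be used in either order. *)
Definition solvable a : Prop :=
  exists (alpha : 'rV[R]_2 -> R^o) (g : 'I_2 -> 'rV[R]_2 -> R^o),
    [/\ smooth alpha, forall k, smooth (g k),
        forall x, hessian_zeros omega v x -> alpha x = 0 /\ forall k, g k x = 0 &
        forall x, closure omega x -> forall k l,
          a k l x = 2^-1 * (partial l (g k) x + partial k (g l) x) +
                    alpha x * partial l (partial k v) x].

Lemma solvable0 : solvable (fun _ _ _ => 0).
Proof.
exists (fun=> 0), (fun _ _ => 0); split => //.
- exact: smooth_cst.
- by move=> k; exact: smooth_cst.
- by move=> x _ k l; rewrite !partial_cst addr0 mulr0 mul0r addr0.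
Qed.

Lemma solvableD a b : solvable a -> solvable b ->
  solvable (fun k l x => a k l x + b k l x).
Proof.
move=> [alpha [g [salpha sg zg ag]]] [beta [h [sbeta sh zh bh]]].
exists (fun x => alpha x + beta x), (fun k x => g k x + h k x); split.
- exact: smoothD.
- by move=> k; exact: smoothD.
- move=> x zx; have [-> g0] := zg x zx; have [-> h0] := zh x zx.
  by rewrite addr0; split=> // k; rewrite g0 h0 addr0.
- move=> x cx k l.
  have D k' l' := partialD l' (smooth_differentiable x (sg k'))
    (smooth_differentiable x (sh k')).
  have alg (A B G G' H H' S S' p q w : R) :
      A = 2^-1 * (G + G') + p * w -> B = 2^-1 * (H + H') + q * w ->
      S = G + H -> S' = G' + H' ->
      A + B = 2^-1 * (S + S') + (p + q) * w.
    by move=> -> -> -> ->; ring.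
  exact: (alg _ _ _ _ _ _ _ _ _ _ _ (ag x cx k l) (bh x cx k l) (D k l) (D l k)).
Qed.

Lemma eq_solvable a b : (forall x, closure omega x -> forall k l, a k l x = b k l x) ->
  solvable a -> solvable b.
Proof.
move=> ab [alpha [g [salpha sg zg ag]]]; exists alpha, g; split=> //.
by move=> x cx k l; rewrite -ab//; exact: ag.
Qed.

Definition symmetric_on_closure a : Prop :=
  forall x, closure omega x -> forall k l, a k l x = a l k x.

(** The localisation around [C] is by a function [chi] that serves for all strains, so
that localisations around two sets combine as in a partition of unity. *)
Definition solvable_near (C : set 'rV[R]_2) : Prop :=
  exists (chi : 'rV[R]_2 -> R^o) (V : set 'rV[R]_2),
    [/\ smooth chi, open V /\ C `<=` V, forall x, V x -> chi x = 1 &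
        forall a, (forall k l, smooth (a k l)) -> symmetric_on_closure a ->
          solvable (fun k l x => chi x * a k l x)].

Lemma solvable_nearU C D : solvable_near C -> solvable_near D ->
  solvable_near (C `|` D).
Proof.
move=> [f [V [sf [oV CV] f1 solf]]] [g [W [sg [oW DW] g1 solg]]].
have s1f : smooth (fun x => 1 - f x : R^o).
  by apply: smoothB => //; exact: smooth_cst.
exists (fun x => f x + g x * (1 - f x)), (V `|` W); split.
- by apply: smoothD => //; exact: smoothM.
- by split; [exact: openU|exact: setUSS].
- by move=> x [/f1 ->|/g1 ->]; ring.
- move=> a sa syma.
  have solg' : solvable (fun k l x => g x * ((1 - f x) * a k l x)).
    apply: (solg (fun k l x => (1 - f x) * a k l x)) => [k l|x cx k l].
      exact: smoothM.
    by rewrite (syma x cx k l).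
  apply: eq_solvable (solvableD (solf a sa syma) solg') => x _ k l.
  by ring.
Qed.

End Solvability.

(** * Local solutions and their superposition *)

Section LocalSolution.
Context {R : realType} (i j : 'I_2) (ij : i != j).
Implicit Types (x y z : 'rV[R]_2).

(** The displacement at [x] only depends on the strain along the line through [x]. *)
Lemma displacement_eq0 (m a b c : 'rV[R]_2 -> R^o) (B : set 'rV[R]_2) x : closed B ->
  (forall z, ~ B z -> [/\ a z = 0, b z = 0 & c z = 0]) ->
  (forall y, B y -> gap i j m x y != 0) ->
  displacement_i i j m a b c x = 0 /\ displacement_j i j m a b c x = 0.
Proof.
move=> cB off Bx; have oB : open (~` B) by exact: closed_openC.
have line_off t : ~ B (line_point i j m t x).
  by move=> /Bx; rewrite gap_line_point// eqxx.
have partial0 (f : 'rV[R]_2 -> R^o) : (forall z, ~ B z -> f z = 0) ->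
    forall t, partial j f (line_point i j m t x) = 0.
  by move=> f0 t; exact: (@partial_cst_on R (~` B) j f 0 _ oB (line_off t) f0).
have a0 z : ~ B z -> a z = 0 by move=> /off[].
have b0 z : ~ B z -> b z = 0 by move=> /off[].
have c0 z : ~ B z -> c z = 0 by move=> /off[].
have Pa := pot_eq0 (fun t => a0 _ (line_off t)).
have Pb := pot_eq0 (fun t => b0 _ (line_off t)).
have Pc := pot_eq0 (fun t => c0 _ (line_off t)).
have Ma := moment_eq0 (partial0 a a0).
have Mb := moment_eq0 (partial0 b b0).
have Mc := moment_eq0 (partial0 c c0).
have Dj : displacement_j i j m a b c x = 0.
  by rewrite /displacement_j /quadratic Pb Pc Ma Mb Mc; ring.
split => //; rewrite /displacement_i Dj /displacement_along /quadratic Pa Pb Pc.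
by ring.
Qed.

Variables (omega : set 'rV[R]_2) (v : 'rV[R]_2 -> R^o).
Hypotheses (open_omega : open omega) (smooth_v : smooth v).
Hypothesis dev_v : developable omega v.
Hypothesis convex_omega : convex_set (omega : set (convex_lmodType 'rV[R]_2)).
Hypothesis bounded_omega : bounded_set omega.

(** Let [K] be the ruling through [x0], cut by the closed domain. By [ruling_line] the
entry [vjj] is bounded away from [0] on [K], which gives [c] and a cutoff [psi] around
[K]. A point of the closed domain whose own line passes through [x0] is on [K], again
by [ruling_line]; hence the lines of the points where [psi] decreases from [1] to [0]
miss [x0], and by compactness they miss the support [B] of a function [chi]
concentrated near [x0]. *)
Lemma adapted_cutoffs x0 : closure omega x0 -> vjj j v x0 != 0 ->
  exists (c : R) (psi chi : 'rV[R]_2 -> R^o) (V1 F V B : set 'rV[R]_2),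
    [/\ 0 < c,
        [/\ smooth psi, open V1, closed F, F `<=` steep j v c & V1 `<=` F],
        [/\ forall z, V1 z -> psi z = 1 & forall z, ~ F z -> psi z = 0],
        [/\ smooth chi, open V, V x0, closed B & B `<=` V1] &
        [/\ forall z, V z -> chi z = 1, forall z, ~ B z -> chi z = 0 &
          forall x, closure omega x -> F x -> ~ V1 x ->
            \forall x' \near x, forall y, B y -> gap i j (slope i j v c) x' y != 0]].
Proof.
move=> cx0 lx0; pose m0 : R := - (vij i j v x0 / vjj j v x0).
pose K := closure omega `&` [set z | gap i j (fun=> m0) x0 z = 0].
have Kx0 : K x0 by split => //; rewrite /gap /= !subrr mulr0 subr0.
have cK : compact K.
  apply: compact_closedI; first exact: compact_closure_bounded.
  apply: (@closed_comp _ R (fun z => gap i j (fun=> m0) x0 z : R) [set t : R | t = 0]);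
    last exact: closed_eq.
  have sgap : smooth (fun z => z 0 j - x0 0 j - m0 * (z 0 i - x0 0 i) : R^o).
    have sk k : smooth (fun z => z 0 k - x0 0 k : R^o).
      by apply: smoothB; [exact: smooth_coord|exact: smooth_cst].
    by apply: smoothB => //; apply: smoothM => //; exact: smooth_cst.
  by move=> z _; exact: (smooth_continuous sgap).
have K_ruling z : K z -> vjj j v z != 0.
  move=> [cz /eqP]; rewrite subr_eq0 => /eqP gz.
  exact: (proj1 (ruling_line ij open_omega smooth_v dev_v convex_omega cx0 cz lx0 gz)).
have cnl : {within K, continuous (fun z => `|vjj j v z| : R)}.
  apply: continuous_subspaceT => z; apply: continuous_comp; last exact: norm_continuous.
  exact: (smooth_continuous (smooth_vjj j smooth_v)).
have [zmin /set_mem Kzmin zminP] := @EVT_min_rV R _ _ K (ex_intro _ x0 Kx0) cK cnl.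
pose c : R := `|vjj j v zmin| / 2.
have min_pos : 0 < `|vjj j v zmin| by rewrite normr_gt0; exact: K_ruling.
have c_pos : 0 < c by rewrite divr_gt0.
have Ksteep : K `<=` steep j v c.
  move=> z Kz; apply: lt_le_trans (zminP z (mem_set Kz)).
  by rewrite /c ltr_pdivrMr// ltr_pMr// ltr1n.
have [psi [V1 [F [spsi [oV1 KV1] [cptF Fsteep] psi1 psi0]]]] :=
  compact_has_cutoff (open_steep smooth_v (c := c)) cK Ksteep.
have cF : closed F by apply: compact_closed => //; exact: norm_hausdorff.
have V1F : V1 `<=` F.
  move=> z V1z; apply: contrapT => /psi0; rewrite (psi1 z V1z) => /eqP.
  by rewrite oner_eq0.
pose m := slope i j v c.
have cm : continuous m by exact/smooth_continuous/smooth_slope.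
pose E := (closure omega `&` F) `&` ~` V1.
have cE : compact E.
  apply: compact_closedI; last exact: open_closedC.
  by apply: compact_closedI; [exact: compact_closure_bounded|exact: cF].
have Egap x : E x -> gap i j m x x0 != 0.
  move=> [[cx Fx] nV1x]; apply/negP => /eqP gx; apply: nV1x; apply: KV1.
  have sx : steep j v c x by exact: Fsteep.
  have mx : m x = - (vij i j v x / vjj j v x) by exact: (slopeE i c_pos sx).
  have gx' : x0 0 j - x 0 j = - (vij i j v x / vjj j v x) * (x0 0 i - x 0 i).
    by move/eqP: gx; rewrite subr_eq0 mx => /eqP.
  have [_ sl] := ruling_line ij open_omega smooth_v dev_v convex_omega cx cx0
    (steep_neq0 c_pos sx) gx'.
  have alg (p q r s t t' : R) : t' = t -> p - q = t * (r - s) ->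
      q - p - t' * (s - r) = 0.
    move=> -> E0; have -> : q - p = - (p - q) by rewrite opprB.
    by rewrite E0; ring.
  split; first exact: cx.
  exact: (alg _ _ _ _ _ _ (congr1 -%R sl) gx').
have near_x0 := compact_near_gap cm cE Egap.
have nbhsU : nbhs x0 (V1 `&` [set y | forall x, E x -> gap i j m x y != 0]).
  by apply: filterI near_x0; apply: open_nbhs_nbhs; split => //; exact: KV1.
have [chi [V [B [schi [oV Vx0] [cptB BU] chi1 chi0]]]] := has_cutoff_point nbhsU.
exists c, psi, chi, V1, F, V, B; split => //.
- split => //; first exact: Vx0.
    by apply: compact_closed => //; exact: norm_hausdorff.
  by move=> z /BU[].
- split => // x cx Fx nV1x; apply: near_compact_gap => // y By.
  by have [_] := BU y By; apply.
Qed.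

(** Close to the ruling, where [psi] is [1], the displacement solves the equations; where
[psi] is neither [1] nor [0] the displacement itself vanishes, as the lines there miss
the support of the strain; farther away the cutoff makes it vanish. *)
Lemma local_equations x0 : closure omega x0 -> vjj j v x0 != 0 ->
  exists (chi : 'rV[R]_2 -> R^o) (V : set 'rV[R]_2),
    [/\ smooth chi, open V /\ V x0, forall z, V z -> chi z = 1 &
    forall a b d : 'rV[R]_2 -> R^o, smooth a -> smooth b -> smooth d ->
    exists alpha gi gj : 'rV[R]_2 -> R^o,
    [/\ [/\ smooth alpha, smooth gi & smooth gj],
      forall x, vjj j v x = 0 -> [/\ alpha x = 0, gi x = 0 & gj x = 0] &
      forall x, closure omega x ->
        [/\ chi x * a x = partial i gi x + alpha x * partial i (partial i v) x,
            2 * (chi x * b x) =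
              partial j gi x + partial i gj x + 2 * (alpha x * vij i j v x) &
            chi x * d x = partial j gj x + alpha x * vjj j v x]]].
Proof.
move=> cx0 lx0.
have [c [psi [chi [V1 [F [V [B [c_pos [spsi oV1 cF Fsteep V1F] [psi1 psi0]
  [schi oV Vx0 cB BV1] [chi1 chi0 gapB]]]]]]]]] := adapted_cutoffs cx0 lx0.
exists chi, V; split=> // a b d sa sb sd.
pose m := slope i j v c.
have sm : smooth m by exact: smooth_slope.
pose A : 'rV[R]_2 -> R^o := fun x => chi x * a x.
pose b' : 'rV[R]_2 -> R^o := fun x => chi x * b x.
pose D : 'rV[R]_2 -> R^o := fun x => chi x * d x.
have sA : smooth A by exact: smoothM.
have sb' : smooth b' by exact: smoothM.
have sD : smooth D by exact: smoothM.
pose Di := displacement_i i j m A b' D.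
pose Dj := displacement_j i j m A b' D.
have sDi : smooth Di by exact: (smooth_displacement_i ij sm sA sb' sD).
have sDj : smooth Dj by exact: (smooth_displacement_j ij sm sA sb' sD).
pose gi : 'rV[R]_2 -> R^o := fun x => psi x * Di x.
pose gj : 'rV[R]_2 -> R^o := fun x => psi x * Dj x.
have sgi : smooth gi by exact: smoothM.
have sgj : smooth gj by exact: smoothM.
have sl := smooth_vjj j smooth_v.
pose alpha : 'rV[R]_2 -> R^o :=
  fun x => (D x - partial j gj x) * soft_inv c (vjj j v x).
have salpha : smooth alpha.
  apply: smoothM; last exact: (smooth_soft_inv c_pos sl).
  by apply: smoothB; [exact: sD|exact: smooth_partial].
exists alpha, gi, gj; split; first by split; [exact: salpha|exact: sgi|exact: sgj].
  move=> x lx.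
  have psix : psi x = 0.
    apply: psi0 => Fx; have := steep_neq0 c_pos (Fsteep x Fx).
    by rewrite lx eqxx.
  by rewrite /alpha /gi /gj lx soft_inv0 psix mulr0 !mul0r.
move=> x cx; case: (pselect (V1 x)) => [V1x|nV1x].
  have sx : steep j v c x by apply/Fsteep/V1F.
  have burgers := slope_burgers ij open_omega smooth_v dev_v c_pos cx sx.
  have [E1 E2] := displacement_equations ij sm sA sb' sD burgers.
  have giE k : partial k gi x = partial k Di x.
    apply: (@eq_on_partial R V1 k gi Di x oV1 V1x) => z V1z.
    by rewrite /gi (psi1 z V1z) mul1r.
  have gjE k : partial k gj x = partial k Dj x.
    apply: (@eq_on_partial R V1 k gj Dj x oV1 V1x) => z V1z.
    by rewrite /gj (psi1 z V1z) mul1r.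
  have lx := steep_neq0 c_pos sx.
  have alphaE : alpha x = (D x - partial j Dj x) / vjj j v x.
    by rewrite /alpha gjE soft_invE// ltW.
  have H1 := hessian_slope_closure ij smooth_v dev_v c_pos cx sx.
  have H2 := @slope_vjj R i j v c x c_pos sx.
  have alg (al l s aa bb dd gii gij gji gjj h1 h2 ii ij' ji jj : R) : l != 0 ->
      aa = ii + (dd - jj) * (s * s) -> 2 * bb = ij' + ji - 2 * (dd - jj) * s ->
      gii = ii -> gij = ij' -> gji = ji -> gjj = jj -> al = (dd - jj) / l ->
      h1 = s * s * l -> h2 = - (s * l) ->
      [/\ aa = gii + al * h1, 2 * bb = gij + gji + 2 * (al * h2) &
          dd = gjj + al * l].
    move=> l_neq0 -> -> -> -> -> -> -> -> ->.
    by split; field.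
  exact: (alg _ _ _ _ _ _ _ _ _ _ _ _ _ _ _ _ lx E1 E2
    (giE i) (giE j) (gjE i) (gjE j) alphaE H1 H2).
have chi_off z : ~ B z -> [/\ A z = 0, b' z = 0 & D z = 0].
  by move=> /chi0 z0; rewrite /A /b' /D z0 !mul0r.
have near0 : \forall y \near x, gi y = 0 /\ gj y = 0.
  have [Fx|nFx] := pselect (F x).
    apply: filterS (gapB x cx Fx nV1x) => y gap_y.
    have [y_i y_j] := displacement_eq0 cB chi_off gap_y.
    have yi : Di y = 0 by exact: y_i.
    have yj : Dj y = 0 by exact: y_j.
    by rewrite /gi /gj yi yj !mulr0.
  have oF : open (~` F) by exact: closed_openC.
  apply: filterS (open_nbhs_nbhs (conj oF nFx)) => y nFy.
  by rewrite /gi /gj (psi0 y nFy) !mul0r.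
have partial0 k (f : 'rV[R]_2 -> R^o) : {near x, f =1 (fun=> 0)} -> partial k f x = 0.
  by move=> f0; rewrite (near_eq_partial k f0) partial_cst.
have gi0 k : partial k gi x = 0.
  by apply: partial0; apply: filterS near0 => y [].
have gj0 k : partial k gj x = 0.
  by apply: partial0; apply: filterS near0 => y [].
have chix : chi x = 0 by apply: chi0 => /BV1.
have alpha0 : alpha x = 0 by rewrite /alpha /D chix gj0 mul0r subrr mul0r.
have alg (al u a' b'' d' gii gij gji gjj h1 h2 l : R) : al = 0 -> u = 0 -> gii = 0 ->
    gij = 0 -> gji = 0 -> gjj = 0 -> [/\ u * a' = gii + al * h1,
    2 * (u * b'') = gij + gji + 2 * (al * h2) & u * d' = gjj + al * l].
  by move=> -> -> -> -> -> ->; split; ring.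
exact: (alg _ _ _ _ _ _ _ _ _ _ _ _ alpha0 chix (gi0 i) (gi0 j) (gj0 i) (gj0 j)).
Qed.

(** In the coordinates i, j, the three equations are the whole matrix equation. *)
Lemma solvable_near_point x0 : closure omega x0 -> vjj j v x0 != 0 ->
  exists2 U, nbhs x0 U & solvable_near omega v U.
Proof.
move=> cx0 lx0; have [chi [V [schi [oV Vx0] chi1 sol]]] := local_equations cx0 lx0.
exists V; first exact: (open_nbhs_nbhs (conj oV Vx0)).
exists chi, V; split; [exact: schi|by split|exact: chi1|move=> a sa syma].
have [alpha [gi [gj [[salpha sgi sgj] zeros eqs]]]] := sol _ _ _ (sa i i) (sa i j) (sa j j).
exists alpha, (fun k => if k == i then gi else gj); split.
- exact: salpha.
- by move=> k; case: ifP.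
- move=> x [cx hx].
  have lx : vjj j v x = 0.
    by have := congr1 (fun M : 'M[R]_2 => M j j) hx; rewrite !mxE.
  by have [-> gi0 gj0] := zeros x lx; split=> // k; case: ifP.
- move=> x cx k l; have [E1 E2 E3] := eqs x cx.
  have ji : (j == i) = false by rewrite eq_sym; exact: negbTE.
  have alg1 (p q r : R) : p = q + r -> p = 2^-1 * (q + q) + r by move=> ->; field.
  have alg2 (p q r s : R) : 2 * p = q + r + 2 * s -> p = 2^-1 * (q + r) + s.
    move=> E; have -> : p = 2^-1 * (2 * p) by field.
    by rewrite E; field.
  case: (ord2_case k ij) => ->; case: (ord2_case l ij) => ->; rewrite ?eqxx ?ji.
  + exact: (alg1 _ _ _ E1).
  + exact: (alg2 _ _ _ _ E2).
  + have symx := syma x cx j i.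
    have S : partial i (partial j v) x = vij i j v x by exact: partialC.
    rewrite symx S [partial i gj x + _]addrC.
    exact: (alg2 _ _ _ _ E2).
  + exact: (alg1 _ _ _ E3).
Qed.

End LocalSolution.

Lemma developable_closure (R : realType) (omega : set 'rV[R]_2) (v : 'rV[R]_2 -> R^o)
    (i j : 'I_2) x : smooth v -> developable omega v -> i != j -> closure omega x ->
  vjj i v x * vjj j v x = vij i j v x * vij i j v x.
Proof.
move=> sv dev ij cx; apply/eqP; rewrite -subr_eq0; apply/eqP.
have si := smooth_vjj i sv; have sj := smooth_vjj j sv; have sij := smooth_vij i j sv.
apply: (@continuous_eq0_closure R omega setT
  (fun x => vjj i v x * vjj j v x - vij i j v x * vij i j v x) _ openT _ x cx I).
  by apply: smooth_continuous; apply: smoothB; exact: smoothM.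
move=> z oz _; apply/eqP; rewrite subr_eq0; apply/eqP.
exact: (etrans (dev i j z ij oz) (expr2 _)).
Qed.

(** At a point where the Hessian, being singular, does not vanish, one of its diagonal
entries does not vanish either, and one of the two orders of the coordinates works. *)
Lemma compact_solvable_near (R : realType) (omega : set 'rV[R]_2) (v : 'rV[R]_2 -> R^o)
    (C : set 'rV[R]_2) : open omega ->
  convex_set (omega : set (convex_lmodType 'rV[R]_2)) -> bounded_set omega ->
  smooth v -> developable omega v -> compact C -> C `<=` closure omega ->
  (forall x, C x -> hessian v x <> 0) -> solvable_near omega v C.
Proof.
move=> oo co bo sv dev cC Cc hC; apply: compact_local_to_global cC.
- exists (fun=> 0), set0; split=> //; first exact: smooth_cst.
    by split => //; exact: open0.
  move=> a _ _; apply: eq_solvable (solvable0 omega v) => x _ k l.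
  by rewrite mul0r.
- exact: solvable_nearU.
- move=> A B AB [chi [V [schi [oV BV] chi1 sol]]].
  exists chi, V; split => //; split => //; exact: subset_trans AB BV.
- move=> x Cx; have cx := Cc x Cx.
  have [l0|l0] := eqVneq (vjj 0 v x) 0; last first.
    exact: (@solvable_near_point R 1 0 isT omega v oo sv dev co bo x cx l0).
  have [l1|l1] := eqVneq (vjj 1 v x) 0; last first.
    exact: (@solvable_near_point R 0 1 isT omega v oo sv dev co bo x cx l1).
  have ij : (0 : 'I_2) != 1 by [].
  have := developable_closure sv dev ij cx; rewrite l0 l1 mul0r => /esym/eqP.
  rewrite mulf_eq0 orbb => /eqP l01.
  have l10 : partial 0 (partial 1 v) x = 0 by exact: (etrans (partialC 1 0 x sv) l01).
  case: (hC x Cx); apply/matrixP => k l; rewrite !mxE.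
  case: (ord2_case k ij) => ->; case: (ord2_case l ij) => ->.
  + exact: l0.
  + exact: l01.
  + exact: l10.
  + exact: l1.
Qed.

Theorem theorem13 (R : realType) (omega : set 'rV[R]_2)
    (omega_bounded : bounded_set omega)
    (omega_convex : convex_set (omega : set (convex_lmodType 'rV[R]_2)))
    (omega_Lipschitz : Lipschitz_domain omega)
    (v : 'rV[R]_2 -> R^o) (v_V0 : V0 omega v)
    (A : 'rV[R]_2 -> 'M[R]_2) (A_smooth : smooth A)
    (A_sym : forall x, closure omega x -> (A x)^T = A x)
    (A_zero : exists U : set 'rV[R]_2,
        [/\ open U, hessian_zeros omega v `<=` U &
            forall x, closure omega x -> U x -> A x = 0]) :
  exists alpha g1 g2 : 'rV[R]_2 -> R^o,
    [/\ [/\ smooth alpha, smooth g1 & smooth g2],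
        forall x, hessian_zeros omega v x ->
          [/\ alpha x = 0, g1 x = 0 & g2 x = 0] &
        forall x, closure omega x ->
          A x = sym_grad (fun z => row2 (g1 z) (g2 z)) x + alpha x *: hessian v x].
Proof.
have [[oo _ _] _] := omega_Lipschitz.
have sv : smooth v by case: v_V0.
have dev := V0_developable oo v_V0.
have [U [oU zU AU]] := A_zero.
have cC : compact (closure omega `&` ~` U).
  by apply: compact_closedI; [exact: compact_closure_bounded|exact: open_closedC].
have [|x [cx nUx] hx|chi [V [_ [_ CV] chi1 sol]]] :=
    compact_solvable_near oo omega_convex omega_bounded sv dev cC.
- exact: subIsetl.
- by apply: nUx; apply: zU.
have sA k l : smooth (fun x => A x k l : R^o) by exact: smooth_entry.
have symA : symmetric_on_closure omega (fun k l x => A x k l).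
  by move=> x cx k l; rewrite -[in LHS](A_sym x cx) mxE.
have : solvable omega v (fun k l x => A x k l).
  apply: eq_solvable (sol _ sA symA) => x cx k l.
  have [Ux|nUx] := pselect (U x); first by rewrite AU// mxE mulr0.
  by rewrite chi1 ?mul1r//; exact: CV.
move=> [alpha [g [salpha sg zg Ag]]].
exists alpha, (g 0), (g 1); split; first by split.
  by move=> x /zg[-> g0]; rewrite !g0.
move=> x cx; apply/matrixP => k l.
have gE k' : (if k' == 0 then g 0 else g 1) = g k'.
  by case: (@ord2_case 0 1 k') => // ->.
have G a b : grad (fun z => row2 (g 0 z) (g 1 z)) x a b = partial b (g a) x.
  by rewrite (grad_row2 x a b (sg 0) (sg 1)) gE.
have -> : (sym_grad (fun z => row2 (g 0 z) (g 1 z)) x + alpha x *: hessian v x) k l =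
    2^-1 * (grad (fun z => row2 (g 0 z) (g 1 z)) x k l +
            grad (fun z => row2 (g 0 z) (g 1 z)) x l k) + alpha x * hessian v x k l.
  by rewrite /sym_grad !mxE.
by rewrite !G (Ag x cx k l) [hessian v x k l]mxE.
Qed.
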